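(* Let $B$ be a path connected, locally path connected and semilocally simply connected space with basepoint $b_0$ and universal covering space $\widetilde B\to B$. Suppose that $G=\pi_1(B,b_0)$ is countable, and let $p:E\to B$ be a covering space with basepoint $e_0\in p^{-1}(b_0)$. The right cosets $p_*(\pi_1(E,e_0))\backslash G$ form an orderable right $G$-set if and only if there exists a bundle embedding $f:E\hookrightarrow\mathbb{R}\times B$ such that $\pi_2\circ f=p$, where $\pi_2:\mathbb{R}\times B\to B$ is the projection onto the second factor. In particular, $G$ is right-orderable if and only if there is a bundle embedding $\widetilde B\hookrightarrow\mathbb{R}\times B$ (that is, one commuting with the projections to $B$).
   Context: A group $G$ is right-orderable if there is a strict total ordering $<$ of $G$ such that $g<h$ implies $gf<hf$ for all $f,g,h\in G$. For a subgroup $H\le G$, $H\backslash G$ is the set of right cosets $Hg$ with right $G$-action $(Hg)\cdot k=Hgk$. A right $G$-set $X$ is orderable if there is a $G$-invariant subset $R\subset X\times X$ (for the diagonal action) which is a strict total order on $X$: $R\circ R\subset R$, $R\cap\Delta_X=\emptyset$, $R\cap R^{op}=\emptyset$, and $R\cup R^{op}=(X\times X)\setminus\Delta_X$. Here $\Delta_X$ is the diagonal, $R^{op}=\{(x,y):(y,x)\in R\}$ and $R\circ R=\{(x,z):\exists y,\ (x,y)\in R,\ (y,z)\in R\}$. Equivalently, there is a strict total order $<$ on $X$ with $x<y\Rightarrow x\cdot g<y\cdot g$ for all $g\in G$. The product in $\pi_1(B,b_0)$ is concatenation of loops, first factor traversed first. A bundle embedding $E\hookrightarrow\mathbb{R}\times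 B$ means an injective continuous map over $B$.
   Formalization: B is additionally assumed paracompact and Hausdorff (the claim fails for the four-point pseudo-circle), and the covering space E is assumed path connected (the claim fails for B = S^1 and E the disjoint union of the line and the connected double cover). *)

(* Defs.v *)
From HB Require Import structures.
From mathcomp Require Import all_boot all_order all_algebra generic_quotient.
From mathcomp Require Import all_classical reals topology normedtype homotopy.
From mathcomp Require Import lra.

Set Implicit Arguments.
Unset Strict Implicit.
Unset Printing Implicit Defensive.

Import Order.TTheory GRing.Theory Num.Theory.
Import numFieldTopology.Exports numFieldNormedType.Exports.

Local Open Scope classical_set_scope.
Local Open Scope ring_scope.
Local Open Scope quotient_scope.

Definition right_orderable (G : groupType) : Prop :=
  exists lt : G -> G -> Prop,
    [/\ forall g, ~ lt g g,
        forall g h k, lt g h -> lt h k -> lt g k,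
        forall g h, g <> h -> lt g h \/ lt h g &
        forall f g h, lt g h -> lt (g * f)%g (h * f)%g].

Record rightGSet (G : groupType) := RightGSet {
  rgset_sort :> Type;
  ract : rgset_sort -> G -> rgset_sort;
  ract1 : forall x, ract x 1%g = x;
  ractM : forall x g h, ract x (g * h)%g = ract (ract x g) h
}.

Definition orderable (G : groupType) (X : rightGSet G) : Prop :=
  exists R : set (X * X),
    [/\ forall x y g, R (x, y) -> R (ract x g, ract y g),
        (R \; R)%relation `<=` R,
        R `&` diagonal = set0,
        R `&` (R^-1)%relation = set0 &
        R `|` (R^-1)%relation = ~` diagonal].

Section RightCosets.
Variables (G : groupType) (H : set G).

Definition right_coset (g : G) : set G := [set (h * g)%g | h in H].

Definition rtranslate (A : set G) (k : G) : set G := [set (a * k)%g | a in A].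

Lemma rtranslate_coset g k :
  rtranslate (right_coset g) k = right_coset (g * k)%g.
Proof.
apply/seteqP; split=> [_ [_ [h Hh <-] <-]|_ [h Hh <-]].
  by exists h => //; rewrite mulgA.
by exists (h * g)%g; [exists h|rewrite mulgA].
Qed.

Definition right_cosets : set (set G) := range right_coset.

Lemma rtranslate_right_cosets (A : right_cosets) (k : G) :
  rtranslate (\val A) k \in right_cosets.
Proof.
case: A => A /= /set_mem[g _ <-]; apply/mem_set.
by exists (g * k)%g => //; rewrite rtranslate_coset.
Qed.

Definition coset_ract (A : right_cosets) (k : G) : right_cosets :=
  exist _ (rtranslate (\val A) k) (rtranslate_right_cosets A k).

Lemma coset_ract1 (A : right_cosets) : coset_ract A 1%g = A.
Proof.
apply: val_inj => /=; apply/seteqP; split=> [_ [a Aa <-]|a Aa].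
  by rewrite mulg1.
by exists a; rewrite ?mulg1.
Qed.

Lemma coset_ractM (A : right_cosets) (g h : G) :
  coset_ract A (g * h)%g = coset_ract (coset_ract A g) h.
Proof.
apply: val_inj => /=; apply/seteqP; split=> [_ [a Aa <-]|_ [_ [a Aa <-] <-]].
  by exists (a * g)%g; [exists a|rewrite mulgA].
by exists a => //; rewrite mulgA.
Qed.

Definition coset_gset : rightGSet G := RightGSet coset_ract1 coset_ractM.

End RightCosets.

(* The library of paths is parametrized by a bipointed domain; here it is the
   subtype [0,1] of R with its subspace topology and endpoints 0 and 1. *)
Definition unit_interval (R : realType) : Type := set_type `[0%R : R, 1%R]%classic.

Section UnitInterval.
Variable R : realType.
Notation I := (unit_interval R).

HB.instance Definition _ := Topological.on I.

Lemma clamp_subproof (r : R) : Num.max 0 (Num.min 1 r) \in `[0%R : R, 1%R]%classic.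
Proof.
by apply/mem_set; rewrite /= in_itv /= le_max lexx ge_max ler01 ge_min lexx.
Qed.

Definition clamp (r : R) : I :=
  exist (fun x : R => x \in `[0%R, 1%R]%classic) _ (clamp_subproof r).

Definition ival (t : I) : R := \val t.

Lemma ival_itv t : (0 <= ival t) && (ival t <= 1).
Proof. by have /set_mem := valP t; rewrite /= in_itv. Qed.

Lemma ival_inj : injective ival.
Proof. exact: val_inj. Qed.

Lemma ival_clamp r : ival (clamp r) = Num.max 0 (Num.min 1 r).
Proof. by []. Qed.

Lemma ival_clampK r : 0 <= r <= 1 -> ival (clamp r) = r.
Proof. by move=> /andP[r0 r1]; rewrite ival_clamp (min_idPr r1) (max_idPr r0). Qed.

Lemma clampK t : clamp (ival t) = t.
Proof. by apply: ival_inj; rewrite ival_clampK // ival_itv. Qed.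

Lemma unit_interval_neq : clamp 0 != clamp 1.
Proof.
apply/eqP => /(congr1 ival); rewrite !ival_clampK ?lexx ?ler01 //.
by apply/eqP; rewrite eq_sym oner_eq0.
Qed.

HB.instance Definition _ := isBiPointed.Build I unit_interval_neq.

Lemma ival0 : ival zero = 0.
Proof. by rewrite ival_clampK // lexx ler01. Qed.

Lemma ival1 : ival one = 1.
Proof. by rewrite ival_clampK // lexx ler01. Qed.

Lemma clamp_le0 r : r <= 0 -> clamp r = zero.
Proof.
move=> r0; apply: ival_inj; rewrite ival_clamp ival0; apply/max_idPl.
by rewrite ge_min r0 orbT.
Qed.

Lemma clamp_ge1 r : 1 <= r -> clamp r = one.
Proof.
by move=> r1; apply: ival_inj; rewrite ival_clamp ival1 (min_idPl r1) max_r.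
Qed.

Lemma ival_continuous : continuous ival.
Proof. exact: initial_continuous. Qed.

Lemma clamp_continuous : continuous clamp.
Proof.
apply: continuous_comp_initial => x.
apply: (@continuous_max R R (fun=> 0) (fun r => Num.min 1 r)); first exact: cvg_cst.
by apply: (@continuous_min R R (fun=> 1) id); [exact: cvg_cst|exact: cvg_id].
Qed.

End UnitInterval.

Section Pasting.
Variables (R : realType) (X T : topologicalType).

Lemma continuous_paste (h : X -> R) (f g : X -> T) :
  continuous h -> continuous f -> continuous g ->
  (forall x, h x = 0 -> f x = g x) ->
  continuous (fun x => if h x <= 0 then f x else g x).
Proof.
move=> ch cf cg fg x U /=; have [hx0|hx0|hx0] := ltgtP (h x) 0.
- move=> fxU.
  have hlt : \forall y \near x, h y < 0.
    by apply: (ch x [set r | r < 0]); apply: open_nbhs_nbhs; split=> //; exact: open_lt.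
  have nf : \forall y \near x, U (f y) := cf x U fxU.
  by apply: filterS2 hlt nf => y hy Uy; rewrite /= (ltW hy).
- move=> gxU.
  have hgt : \forall y \near x, 0 < h y.
    by apply: (ch x [set r | 0 < r]); apply: open_nbhs_nbhs; split=> //; exact: open_gt.
  have ng : \forall y \near x, U (g y) := cg x U gxU.
  by apply: filterS2 hgt ng => y hy Uy; rewrite /= leNgt hy.
- move=> fxU; have gxU : nbhs (g x) U by rewrite -fg.
  have nf : \forall y \near x, U (f y) := cf x U fxU.
  have ng : \forall y \near x, U (g y) := cg x U gxU.
  by apply: filterS2 nf ng => y fy gy /=; case: ifP.
Qed.

End Pasting.

Section PathHomotopy.
Variables (R : realType) (T : topologicalType).
Notation I := (unit_interval R).
Notation path x y := {path I from x to y in T}.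

Definition path_homotopic (x y : T) (a b : path x y) : Prop :=
  exists H : I * I -> T,
    [/\ continuous H,
        forall t, H (t, zero) = a t,
        forall t, H (t, one) = b t,
        forall s, H (zero, s) = x &
        forall s, H (one, s) = y].

Lemma path_homotopic_refl x y (a : path x y) : path_homotopic a a.
Proof.
exists (fun z => a z.1); split=> //= [z|_|_]; last 2 first.
- exact: path_zero.
- exact: path_one.
by apply: continuous_comp; [exact: cvg_fst|exact: cts_fun].
Qed.

Lemma continuous_pair2 (X Y Z : topologicalType) (f : X -> Y) (g : X -> Z) :
  continuous f -> continuous g -> continuous (fun x => (f x, g x)).
Proof. by move=> cf cg x; apply: cvg_pair; [exact: cf|exact: cg]. Qed.

Lemma continuous_comp2 (X Y Z : topologicalType) (f : X -> Y) (g : Y -> Z) :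
  continuous f -> continuous g -> continuous (fun x => g (f x)).
Proof.
by move=> cf cg x; apply: (@continuous_comp _ _ _ f g); [exact: cf|exact: cg].
Qed.

Section RealFunctions.
Variable X : topologicalType.
Implicit Types f g : X -> R.

Lemma rcontD f g : continuous f -> continuous g -> continuous (fun x => f x + g x).
Proof. by move=> cf cg x; apply: (@continuousD R R); [exact: cf|exact: cg]. Qed.

Lemma rcontB f g : continuous f -> continuous g -> continuous (fun x => f x - g x).
Proof. by move=> cf cg x; apply: (@continuousB R R); [exact: cf|exact: cg]. Qed.

Lemma rcontM f g : continuous f -> continuous g -> continuous (fun x => f x * g x).
Proof. by move=> cf cg x; apply: (@continuousM R); [exact: cf|exact: cg]. Qed.

Lemma rcont_min f g :
  continuous f -> continuous g -> continuous (fun x => Num.min (f x) (g x)).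
Proof.
by move=> cf cg x; apply: (@continuous_min R X f g); [exact: cf|exact: cg].
Qed.

Lemma rcont_cst (c : R) : continuous (fun _ : X => c).
Proof. by move=> x; exact: cvg_cst. Qed.

End RealFunctions.

Lemma rcont_fst : continuous (fun z : I * I => ival z.1).
Proof.
apply: (@continuous_comp2 _ _ _ fst (@ival R)); last exact: ival_continuous.
by move=> z; exact: cvg_fst.
Qed.

Lemma rcont_snd : continuous (fun z : I * I => ival z.2).
Proof.
apply: (@continuous_comp2 _ _ _ snd (@ival R)); last exact: ival_continuous.
by move=> z; exact: cvg_snd.
Qed.

Lemma continuous_clamp (X : topologicalType) (f : X -> R) :
  continuous f -> continuous (fun x => clamp (f x)).
Proof. by move=> cf; apply: continuous_comp2 cf _; exact: clamp_continuous. Qed.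

Ltac rcont :=
  repeat first
    [ exact: rcont_cst | exact: rcont_fst | exact: rcont_snd
    | exact: ival_continuous | apply: rcontB | apply: rcontD | apply: rcontM
    | apply: rcont_min | apply: continuous_clamp].

Lemma path_homotopic_sym x y (a b : path x y) :
  path_homotopic a b -> path_homotopic b a.
Proof.
move=> [H [cH H0 H1 Hx Hy]].
exists (fun z => H (z.1, clamp (1 - ival z.2))); split=> //= [|t|t].
- apply: (@continuous_comp2 _ _ _ (fun z : I * I => (z.1, clamp (1 - ival z.2))) H) => //.
  by apply: continuous_pair2; [move=> z; exact: cvg_fst|rcont].
- by rewrite ival0 subr0.
- by rewrite ival1 subrr.
Qed.

Lemma path_homotopic_trans x y (a b c : path x y) :
  path_homotopic a b -> path_homotopic b c -> path_homotopic a c.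
Proof.
move=> [H [cH H0 H1 Hx Hy]] [K [cK K0 K1 Kx Ky]].
exists (fun z => if 2 * ival z.2 - 1 <= 0 then H (z.1, clamp (2 * ival z.2))
                 else K (z.1, clamp (2 * ival z.2 - 1))); split.
- apply: (@continuous_paste R _ _ (fun z : I * I => 2 * ival z.2 - 1)
     (fun z => H (z.1, clamp (2 * ival z.2)))
     (fun z => K (z.1, clamp (2 * ival z.2 - 1)))).
  + rcont.
  + apply: (@continuous_comp2 _ _ _ (fun z : I * I => (z.1, clamp (2 * ival z.2))) H) => //.
    by apply: continuous_pair2; [move=> z; exact: cvg_fst|rcont].
  + apply: (@continuous_comp2 _ _ _ (fun z : I * I => (z.1, clamp (2 * ival z.2 - 1))) K) => //.
    by apply: continuous_pair2; [move=> z; exact: cvg_fst|rcont].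
  + move=> z z0; rewrite clamp_ge1; last by lra.
    by rewrite clamp_le0; [rewrite H1 K0|lra].
- by move=> t /=; rewrite ival0 ifT ?mulr0 ?sub0r ?lerN10 // clamp_le0.
- move=> t /=; rewrite ival1 ifF; last by apply/negbTE; rewrite -ltNge; lra.
  by rewrite clamp_ge1 // ; lra.
- by move=> s /=; rewrite Hx Kx if_same.
- by move=> s /=; rewrite Hy Ky if_same.
Qed.

Lemma path_homotopic_reparam x y u v (c : path x y) (phi psi : I -> I)
    (a b : path u v) :
  continuous phi -> continuous psi -> phi zero = psi zero -> phi one = psi one ->
  (forall t, a t = c (phi t)) -> (forall t, b t = c (psi t)) ->
  path_homotopic a b.
Proof.
move=> cphi cpsi pp0 pp1 aE bE.
pose F (z : I * I) : I :=
  clamp (ival (phi z.1) + ival z.2 * (ival (psi z.1) - ival (phi z.1))).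
exists (fun z => c (F z)); split=> [|t|t|s|s].
- apply: (@continuous_comp2 _ _ _ F c); last exact: cts_fun.
  have cival (f : I -> I) : continuous f ->
      continuous (fun z : I * I => ival (f z.1)).
    move=> cf; apply: (@continuous_comp2 _ _ _ (fun z : I * I => f z.1) (@ival R)).
      by apply: (@continuous_comp2 _ _ _ fst f) => // z; exact: cvg_fst.
    exact: ival_continuous.
  apply: continuous_clamp; apply: rcontD; first exact: cival.
  apply: rcontM; first exact: rcont_snd.
  by apply: rcontB; exact: cival.
- by rewrite /F /= ival0 mul0r addr0 clampK.
- by rewrite /F /= ival1 mul1r addrC subrK clampK.
- by rewrite /F /= pp0 subrr mulr0 addr0 clampK -bE path_zero.
- by rewrite /F /= pp1 subrr mulr0 addr0 clampK -bE path_one.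
Qed.

Section Concat.
Variables (x y z : T) (a : path x y) (b : path y z).

Definition concat_fun (t : I) : T :=
  if 2 * ival t - 1 <= 0 then a (clamp (2 * ival t))
  else b (clamp (2 * ival t - 1)).

Lemma concat_fun_continuous : continuous concat_fun.
Proof.
apply: (@continuous_paste R _ _ (fun t : I => 2 * ival t - 1)
   (fun t => a (clamp (2 * ival t))) (fun t => b (clamp (2 * ival t - 1)))).
- rcont.
- by apply: continuous_comp2; [rcont|exact: cts_fun].
- by apply: continuous_comp2; [rcont|exact: cts_fun].
- move=> t t0; rewrite clamp_ge1; last by lra.
  by rewrite clamp_le0; [rewrite path_one path_zero|lra].
Qed.

Lemma concat_fun0 : concat_fun zero = x.
Proof.
rewrite /concat_fun ival0 ifT ?mulr0 ?sub0r ?lerN10 //.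
by rewrite clamp_le0 // path_zero.
Qed.

Lemma concat_fun1 : concat_fun one = z.
Proof.
rewrite /concat_fun ival1 ifF; last by apply/negbTE; rewrite -ltNge; lra.
by rewrite clamp_ge1 ?path_one //; lra.
Qed.

Definition path_concat : path x z :=
  mk_path concat_fun_continuous concat_fun0 concat_fun1.

Lemma path_concatE t : path_concat t =
  if 2 * ival t - 1 <= 0 then a (clamp (2 * ival t))
  else b (clamp (2 * ival t - 1)).
Proof. by []. Qed.

End Concat.

Section Reverse.
Variables (x y : T) (a : path x y).

Definition reverse_fun (t : I) : T := a (clamp (1 - ival t)).

Lemma reverse_fun_continuous : continuous reverse_fun.
Proof. by apply: continuous_comp2; [rcont|exact: cts_fun]. Qed.

Lemma reverse_fun0 : reverse_fun zero = y.
Proof. by rewrite /reverse_fun ival0 subr0 path_one. Qed.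

Lemma reverse_fun1 : reverse_fun one = x.
Proof. by rewrite /reverse_fun ival1 subrr path_zero. Qed.

Definition path_reverse : path y x :=
  mk_path reverse_fun_continuous reverse_fun0 reverse_fun1.

End Reverse.

Definition path_const (x : T) : path x x := cst x.

Lemma path_homotopic_concat x y z (a a' : path x y) (b b' : path y z) :
  path_homotopic a a' -> path_homotopic b b' ->
  path_homotopic (path_concat a b) (path_concat a' b').
Proof.
move=> [H [cH H0 H1 Hx Hy]] [K [cK K0 K1 Kx Ky]].
exists (fun w => if 2 * ival w.1 - 1 <= 0 then H (clamp (2 * ival w.1), w.2)
                 else K (clamp (2 * ival w.1 - 1), w.2)); split.
- apply: (@continuous_paste R _ _ (fun w : I * I => 2 * ival w.1 - 1)
     (fun w => H (clamp (2 * ival w.1), w.2))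
     (fun w => K (clamp (2 * ival w.1 - 1), w.2))).
  + rcont.
  + apply: (@continuous_comp2 _ _ _ (fun w : I * I => (clamp (2 * ival w.1), w.2)) H) => //.
    by apply: continuous_pair2; [rcont|move=> w; exact: cvg_snd].
  + apply: (@continuous_comp2 _ _ _ (fun w : I * I => (clamp (2 * ival w.1 - 1), w.2)) K) => //.
    by apply: continuous_pair2; [rcont|move=> w; exact: cvg_snd].
  + move=> w w0; rewrite clamp_ge1; last by lra.
    by rewrite clamp_le0; [rewrite Hy Kx|lra].
- by move=> t; rewrite path_concatE /= H0 K0.
- by move=> t; rewrite path_concatE /= H1 K1.
- by move=> s /=; rewrite ival0 ifT ?mulr0 ?sub0r ?lerN10 // clamp_le0.
- move=> s /=; rewrite ival1 ifF; last by apply/negbTE; rewrite -ltNge; lra.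
  by rewrite clamp_ge1 // ; lra.
Qed.

Lemma path_homotopic_reverse x y (a a' : path x y) :
  path_homotopic a a' -> path_homotopic (path_reverse a) (path_reverse a').
Proof.
move=> [H [cH H0 H1 Hx Hy]].
exists (fun w => H (clamp (1 - ival w.1), w.2)); split.
- apply: (@continuous_comp2 _ _ _ (fun w : I * I => (clamp (1 - ival w.1), w.2)) H) => //.
  by apply: continuous_pair2; [rcont|move=> w; exact: cvg_snd].
- by move=> t; rewrite H0.
- by move=> t; rewrite H1.
- by move=> s /=; rewrite ival0 subr0 Hy.
- by move=> s /=; rewrite ival1 subrr Hx.
Qed.

Lemma path_concatA x y z w (a : path x y) (b : path y z) (c : path z w) :
  path_homotopic (path_concat a (path_concat b c))
                 (path_concat (path_concat a b) c).
Proof.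
apply: path_homotopic_sym.
pose r (t : I) : R :=
  Num.min (2 * ival t) (Num.min (ival t + 4^-1) ((ival t + 1) / 2)).
apply: (@path_homotopic_reparam _ _ _ _ (path_concat a (path_concat b c))
  (fun t => clamp (r t)) id) => //.
- by rewrite /r; rcont.
- by move=> t; exact: cvg_id.
- by rewrite clamp_le0 // /r ival0 ge_min mulr0 lexx.
- by rewrite clamp_ge1 // /r ival1 !le_min; apply/and3P; split; lra.
move=> t; have /andP[t0 t1] := ival_itv t.
have rt01 : 0 <= r t <= 1.
  apply/andP; split; rewrite /r; first by rewrite !le_min; apply/and3P; split; lra.
  by rewrite !ge_min; apply/orP; right; apply/orP; right; lra.
rewrite !path_concatE (ival_clampK rt01); case: ifPn => [th|]; last first.
  rewrite -ltNge => th.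
  have -> : r t = (ival t + 1) / 2.
    have e : Num.min (ival t + 4^-1) ((ival t + 1) / 2) = (ival t + 1) / 2.
      by apply/min_idPr; lra.
    by rewrite /r e; apply/min_idPr; lra.
  rewrite ifF; last by apply/negbTE; rewrite -ltNge; lra.
  have -> : 2 * ((ival t + 1) / 2) - 1 = ival t by lra.
  by rewrite clampK ifF //; apply/negbTE; rewrite -ltNge; lra.
rewrite [ival (clamp (2 * ival t))]ival_clampK; last by apply/andP; split; lra.
case: ifPn => [tq|].
  have -> : r t = 2 * ival t.
    by apply/min_idPl; rewrite le_min; apply/andP; split; lra.
  by rewrite ifT.
rewrite -ltNge => tq.
have -> : r t = ival t + 4^-1.
  have e : Num.min (ival t + 4^-1) ((ival t + 1) / 2) = ival t + 4^-1.
    by apply/min_idPl; lra.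
  by rewrite /r e; apply/min_idPr; lra.
rewrite ifF; last by apply/negbTE; rewrite -ltNge; lra.
have -> : 2 * (ival t + 4^-1) - 1 = 2 * ival t - 2^-1 by lra.
rewrite ival_clampK; last by apply/andP; split; lra.
by rewrite ifT; [congr (b (clamp _)); lra|lra].
Qed.

Lemma path_concat1p x y (a : path x y) :
  path_homotopic (path_concat (path_const x) a) a.
Proof.
apply: (@path_homotopic_reparam _ _ _ _ a (fun t => clamp (2 * ival t - 1)) id)
  => //.
- by rcont.
- by move=> t; exact: cvg_id.
- by rewrite clamp_le0 // ival0; lra.
- by rewrite clamp_ge1 // ival1; lra.
move=> t; rewrite path_concatE; case: ifPn => // th.
by rewrite [clamp (_ - _)]clamp_le0 ?path_zero.
Qed.

Lemma path_concatp1 x y (a : path x y) :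
  path_homotopic (path_concat a (path_const y)) a.
Proof.
apply: (@path_homotopic_reparam _ _ _ _ a (fun t => clamp (2 * ival t)) id) => //.
- by rcont.
- by move=> t; exact: cvg_id.
- by rewrite clamp_le0 // ival0; lra.
- by rewrite clamp_ge1 // ival1; lra.
move=> t; rewrite path_concatE; case: ifPn => //; rewrite -ltNge => th.
by rewrite [clamp (2 * _)]clamp_ge1 ?path_one //; lra.
Qed.

Lemma path_concatpV x y (a : path x y) :
  path_homotopic (path_concat a (path_reverse a)) (path_const x).
Proof.
apply: (@path_homotopic_reparam _ _ _ _ a
  (fun t => clamp (Num.min (2 * ival t) (2 - 2 * ival t))) (fun=> zero)) => //.
- by rcont.
- exact: cst_continuous.
- by rewrite clamp_le0 // ival0 ge_min mulr0 lexx.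
- by rewrite clamp_le0 // ival1 ge_min; apply/orP; right; lra.
- move=> t; rewrite path_concatE; case: ifPn => th.
    by congr (a (clamp _)); rewrite min_l //; lra.
  have /andP[t0 t1] := ival_itv t; move: th; rewrite -ltNge => th.
  rewrite /path_reverse /= /mk_path /reverse_fun; congr (a (clamp _)).
  rewrite ival_clampK; last by apply/andP; split; lra.
  by rewrite min_r; lra.
- by move=> t; rewrite path_zero.
Qed.

Lemma path_concatVp x y (a : path x y) :
  path_homotopic (path_concat (path_reverse a) a) (path_const y).
Proof.
apply: (@path_homotopic_reparam _ _ _ _ a
  (fun t => clamp (1 - Num.min (2 * ival t) (2 - 2 * ival t))) (fun=> one)) => //.
- by rcont.
- exact: cst_continuous.
- by rewrite clamp_ge1 // ival0 lerBrDr -lerBrDl subrr ge_min mulr0 lexx.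
- rewrite clamp_ge1 // ival1 lerBrDr -lerBrDl subrr ge_min.
  by apply/orP; right; lra.
- move=> t; have /andP[t0 t1] := ival_itv t.
  rewrite path_concatE; case: ifPn => th.
    rewrite /path_reverse /= /mk_path /reverse_fun; congr (a (clamp _)).
    rewrite ival_clampK; last by apply/andP; split; lra.
    by rewrite min_l //; lra.
  move: th; rewrite -ltNge => th.
  by congr (a (clamp _)); rewrite min_r; lra.
- by move=> t; rewrite path_one.
Qed.

End PathHomotopy.

Section FundamentalGroup.
Variables (R : realType) (T : topologicalType) (x : T).
Notation I := (unit_interval R).
Notation loop := {path I from x to x in T}.

Definition loop_eqv (a b : loop) : bool := `[< path_homotopic a b >].

Lemma loop_eqv_refl : reflexive loop_eqv.
Proof. by move=> a; apply/asboolP; exact: path_homotopic_refl. Qed.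

Lemma loop_eqv_sym : symmetric loop_eqv.
Proof. by move=> a b; apply/asboolP/asboolP; exact: path_homotopic_sym. Qed.

Lemma loop_eqv_trans : transitive loop_eqv.
Proof.
by move=> b a c /asboolP ab /asboolP bc; apply/asboolP; exact: path_homotopic_trans bc.
Qed.

Canonical loop_equiv := EquivRel loop_eqv loop_eqv_refl loop_eqv_sym loop_eqv_trans.

Definition pi1 : Type := {eq_quot loop_equiv}.
HB.instance Definition _ := Choice.on pi1.
HB.instance Definition _ := Quotient.on pi1.

Definition loop_class (a : loop) : pi1 := \pi_pi1 a.

Lemma loop_classP (a b : loop) : loop_class a = loop_class b <-> path_homotopic a b.
Proof. by split=> [/eqmodP/asboolP//|ab]; apply/eqmodP/asboolP. Qed.

Lemma repr_loop_class (a : loop) : path_homotopic (repr (loop_class a)) a.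
Proof. by apply/loop_classP; rewrite /loop_class reprK. Qed.

Definition pi1_one : pi1 := loop_class (path_const R x).
Definition pi1_inv (g : pi1) : pi1 := loop_class (path_reverse (repr g)).
Definition pi1_mul (g h : pi1) : pi1 := loop_class (path_concat (repr g) (repr h)).

Lemma pi1_mulE (a b : loop) :
  pi1_mul (loop_class a) (loop_class b) = loop_class (path_concat a b).
Proof.
by apply/loop_classP; apply: path_homotopic_concat; exact: repr_loop_class.
Qed.

Lemma pi1_invE (a : loop) : pi1_inv (loop_class a) = loop_class (path_reverse a).
Proof.
by apply/loop_classP; apply: path_homotopic_reverse; exact: repr_loop_class.
Qed.

Lemma loop_class_surj (g : pi1) : exists a, g = loop_class a.
Proof. by exists (repr g); rewrite /loop_class reprK. Qed.

Lemma pi1_mulA : associative pi1_mul.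
Proof.
move=> g h k; have [a ->] := loop_class_surj g.
have [b ->] := loop_class_surj h; have [c ->] := loop_class_surj k.
by rewrite !pi1_mulE; apply/loop_classP; exact: path_concatA.
Qed.

Lemma pi1_mul1g : left_id pi1_one pi1_mul.
Proof.
move=> g; have [a ->] := loop_class_surj g.
by rewrite pi1_mulE; apply/loop_classP; exact: path_concat1p.
Qed.

Lemma pi1_mulg1 : right_id pi1_one pi1_mul.
Proof.
move=> g; have [a ->] := loop_class_surj g.
by rewrite pi1_mulE; apply/loop_classP; exact: path_concatp1.
Qed.

Lemma pi1_mulVg : left_inverse pi1_one pi1_inv pi1_mul.
Proof.
move=> g; have [a ->] := loop_class_surj g.
by rewrite pi1_invE pi1_mulE; apply/loop_classP; exact: path_concatVp.
Qed.

Lemma pi1_mulgV : right_inverse pi1_one pi1_inv pi1_mul.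
Proof.
move=> g; have [a ->] := loop_class_surj g.
by rewrite pi1_invE pi1_mulE; apply/loop_classP; exact: path_concatpV.
Qed.

HB.instance Definition _ :=
  isGroup.Build pi1 pi1_mulA pi1_mul1g pi1_mulg1 pi1_mulVg pi1_mulgV.

End FundamentalGroup.

Section InducedMap.
Variables (R : realType) (X Y : topologicalType) (f : continuousType X Y).
Variables (x : X) (y : Y) (fxy : f x = y).
Notation I := (unit_interval R).

Lemma map_loop_continuous (a : {path I from x to x in X}) : continuous (f \o a).
Proof. by move=> t; apply: continuous_comp; exact: cts_fun. Qed.

Lemma map_loop0 (a : {path I from x to x in X}) : (f \o a) zero = y.
Proof. by rewrite /= path_zero. Qed.

Lemma map_loop1 (a : {path I from x to x in X}) : (f \o a) one = y.
Proof. by rewrite /= path_one. Qed.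

Definition map_loop (a : {path I from x to x in X}) : {path I from y to y in Y} :=
  mk_path (@map_loop_continuous a) (map_loop0 a) (map_loop1 a).

Definition pi1_map (g : pi1 R x) : pi1 R y := loop_class (map_loop (repr g)).

Lemma pi1_mapE (a : {path I from x to x in X}) :
  pi1_map (loop_class a) = loop_class (map_loop a).
Proof.
apply/loop_classP; have [H [cH H0 H1 Hx Hy]] := repr_loop_class a.
exists (f \o H); split=> [|t|t|s|s] /=; rewrite ?H0 ?H1 ?Hx ?Hy //.
by move=> z; apply: continuous_comp; [exact: cH|exact: cts_fun].
Qed.

End InducedMap.

Arguments pi1_map R {X Y} f {x y} fxy.

Section Spaces.
Variables (R : realType) (T : topologicalType).
Notation I := (unit_interval R).

Definition path_connected_set (A : set T) : Prop :=
  forall x y, A x -> A y ->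
    exists a : {path I from x to y in T}, forall t, A (a t).

Definition path_connected : Prop :=
  [set: T] !=set0 /\ path_connected_set [set: T].

Definition locally_path_connected : Prop :=
  basis [set V : set T | open V /\ path_connected_set V].

Definition semilocally_simply_connected : Prop :=
  forall x : T, exists2 U : set T, nbhs x U &
    forall a : {path I from x to x in T}, (forall t, U (a t)) ->
      loop_class a = 1%g.

Definition simply_connected : Prop :=
  path_connected /\ forall (x : T) (g : pi1 R x), g = 1%g.

End Spaces.

Definition paracompact (T : topologicalType) : Prop :=
  forall U : set (set T), U `<=` open -> \bigcup_(A in U) A = setT ->
    exists V : set (set T),
      [/\ V `<=` open,
          \bigcup_(A in V) A = setT,
          forall A, V A -> exists2 B, U B & A `<=` B &
          forall x : T, exists2 N, nbhs x N &
            finite_set [set A | V A /\ A `&` N !=set0]].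

Section Coverings.
Variables (E B : topologicalType).

(* [p] restricts to a homeomorphism from [V] to [U] with the subspace topologies;
   the values of [s] outside [U] are irrelevant. *)
Definition homeo_between (p : E -> B) (V : set E) (U : set B) : Prop :=
  [/\ set_bij V U p, {within V, continuous p} &
      exists s : B -> E,
        {within U, continuous s} /\ {in V, cancel p s}].

Definition evenly_covered (p : E -> B) (U : set B) : Prop :=
  exists S : set (set E),
    [/\ p @^-1` U = \bigcup_(V in S) V,
        trivIset S id &
        forall V, S V -> open V /\ homeo_between p V U].

(* The family of sheets may be empty, so surjectivity is not built in; it is
   automatic over a path connected base as soon as one fibre is nonempty. *)
Definition covering_map (p : E -> B) : Prop :=
  continuous p /\
  forall b : B, exists2 U : set B, open_nbhs b U & evenly_covered p U.

Definition bundle_embedding (R : realType) (p : E -> B) (f : E -> R * B) : Prop :=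
  [/\ continuous f, injective f & snd \o f = p].

End Coverings.

Definition universal_covering (R : realType) (E B : topologicalType)
    (p : E -> B) : Prop :=
  covering_map p /\ simply_connected R E.

(* Main.v *)
Require Import Defs.
From mathcomp Require Import all_boot all_order all_algebra.
From mathcomp Require Import all_classical reals topology normedtype sequences homotopy.
From mathcomp Require Import finmap.
From Corelib Require Setoid Morphisms.
Import numFieldTopology.Exports numFieldNormedType.Exports.
Import Order.TTheory GRing.Theory Num.Theory.

Set Implicit Arguments.
Unset Strict Implicit.
Unset Printing Implicit Defensive.

Local Open Scope classical_set_scope.

(** An embedding of [E] into [R * B] over [B] is the same thing as a continuous
    height function [h : E -> R] that is injective on each fibre of [p].  The
    theorem says that such a function exists exactly when the fibre over [b0],
    which is the set of right cosets of [H := p_* pi1(E)] in [G := pi1(B)], has an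
    order that is invariant under the monodromy action of [G].

    From heights to orders ([bundle_embedding_orderable]): order the fibre over
    [b0] by height.  Two points moved along the lifts of one loop stay distinct by
    unique path lifting, hence keep distinct heights, and by connectedness of
    the interval the sign of the difference of heights does not change.

    From orders to heights ([orderable_bundle_embedding]): for a return path [c]
    from [x] to [b0], the set [holonomy e c] of the classes of loops that project
    a path from [e0] to [e] and return along [c] is a right coset of [H], and the
    monodromy theorem makes it distinguish the points over [x].  Another return
    path translates all these cosets by the same element, so an invariant order
    of the cosets orders every fibre, compatibly with transport along sheets.
    Since [G] is countable the cosets embed increasingly and boundedly into [R]
    ([countable_order_embedding]); retracting along sheets gives, over small
    open sets, locally constant functions that increase on fibres.  Increasing
    functions form a convex cone, so these local functions can be combined with
    bump functions subordinate to the cover ([fiberwise_increasing_glue]), which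
    exist because a paracompact Hausdorff space is normal.

    When [E] is simply connected [H] is trivial, and an invariant order of its
    cosets is a right order of [G]. *)

(** * Bump functions on paracompact Hausdorff spaces *)

Section Paracompact.
Variable T : topologicalType.
Implicit Types (x y : T) (A C D N : set T) (U V : set (set T)).

Definition locally_finite V : Prop :=
  forall x, exists2 N, nbhs x N & finite_set [set A | V A /\ A `&` N !=set0].

(** Near a given point only finitely many members of the family matter, and a
    finite union of closed sets is closed. *)
Lemma closed_locally_finite_closure V :
  locally_finite V -> closed (\bigcup_(A in V) closure A).
Proof.
move=> lfV x xcl; have [N Nx finN] := lfV x.
pose W := \bigcup_(A in [set A | V A /\ A `&` N !=set0]) closure A.
have clW : closed W by apply: closed_bigcup => // A _; exact: closed_closure.
have [[A [VA _] Ax]|nWx] := pselect (W x); first by exists A.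
have nbhsWC : nbhs x (~` W).
  by apply: open_nbhs_nbhs; split => //; exact: closed_openC.
have [y [[A VA Ay] [/= nWy Ny]]] := xcl _ (filterI nbhsWC (nbhs_interior Nx)).
case: nWy; exists A => //; split => //.
have [z [Az /interior_subset Nz]] :=
  Ay _ (open_nbhs_nbhs (conj (open_interior N) Ny)).
by exists z.
Qed.

Definition separated_by_opens C D : Prop :=
  exists O Q : set T, [/\ open O, open Q, C `<=` O, D `<=` Q & O `&` Q = set0].

Lemma separated_by_opensC C D : separated_by_opens C D -> separated_by_opens D C.
Proof. by move=> [O [Q [oO oQ CO DQ OQ]]]; exists Q, O; rewrite setIC. Qed.

Hypothesis paracompactT : paracompact T.

(** Paracompactness turns pointwise separation from [D] into separation of the
    whole closed set [C]: refine the cover made of the separating neighbourhoods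
    and of the complement of [C].  The union of the members meeting [C] contains
    [C], and by local finiteness its closure is the union of the closures, none
    of which meets [D].  Taking [D] to be a point gives regularity, and then
    taking [D] to be a closed set gives normality. *)
Lemma paracompact_separate C D : closed C ->
  (forall x, C x -> separated_by_opens [set x] D) -> separated_by_opens C D.
Proof.
move=> clC sepCD.
pose U := [set O | open O /\ (O `<=` ~` C \/
  exists Q, [/\ open Q, D `<=` Q & O `&` Q = set0])].
have [] := @paracompactT U; first by move=> O [].
  apply/seteqP; split => // x _; have [Cx|nCx] := pselect (C x).
    have [O [Q [oO oQ xO DQ OQ]]] := sepCD _ Cx.
    by exists O; [split=> //; right; exists Q|exact: xO].
  by exists (~` C) => //; split; [exact: closed_openC|left].
move=> V [openV coverV refV lfV].
pose W := [set A | V A /\ A `&` C !=set0].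
have lfW : locally_finite W.
  move=> x; have [N Nx finN] := lfV x; exists N => //.
  by apply: sub_finite_set finN => A [[VA _] AN].
exists (\bigcup_(A in W) A), (~` (\bigcup_(A in W) closure A)); split.
- by apply: bigcup_open => A [/openV].
- exact/closed_openC/closed_locally_finite_closure.
- move=> x Cx; have [A VA Ax] : (\bigcup_(A in V) A) x by rewrite coverV.
  by exists A => //; split=> //; exists x.
- move=> d Dd [A [VA [x [Ax Cx]]] Ad].
  have [O [oO [OC|[Q [oQ DQ OQ]]]] AO] := refV _ VA; first exact: (OC _ (AO _ Ax)).
  have [z [Az Qz]] := Ad _ (open_nbhs_nbhs (conj oQ (DQ _ Dd))).
  by have : (O `&` Q) z; [split=> //; exact: AO|rewrite OQ].
- by apply/disjoints_subset; rewrite setCK => x [A WA Ax]; exists A => //;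
  exact: subset_closure.
Qed.

Hypothesis hausdorffT : hausdorff_space T.

Lemma paracompact_separate_point C y : closed C -> ~ C y ->
  separated_by_opens C [set y].
Proof.
move=> clC nCy; apply: paracompact_separate => // x Cx.
have xy : x != y by apply/eqP => xy; apply: nCy; rewrite -xy.
have := hausdorffT; rewrite open_hausdorff => /(_ _ _ xy).
move=> [[O Q] /= [/set_mem Ox /set_mem Qy] [oO oQ /eqP OQ]].
by exists O, Q; split => // z /= ->.
Qed.

Lemma paracompact_normal (R : realType) : normal_space T.
Proof.
apply/(@normal_openP R) => C D clC clD CD.
have [x Cx|O [Q [oO oQ CO DQ OQ]]] := @paracompact_separate C D clC.
  apply/separated_by_opensC/paracompact_separate_point => // Dx.
  by have : (C `&` D) x by []; rewrite CD.
by exists O, Q.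
Qed.

(** By regularity, the open sets whose closure lies in some member of [V] still
    form a cover; refine that one. *)
Lemma paracompact_shrink V : V `<=` open -> \bigcup_(A in V) A = setT ->
  exists W, [/\ locally_finite W, \bigcup_(A in W) A = setT &
    forall A, W A -> exists2 B, V B & closure A `<=` B].
Proof.
move=> openV coverV.
pose U := [set O | open O /\ exists2 B, V B & closure O `<=` B].
have [] := @paracompactT U; first by move=> O [].
  apply/seteqP; split => // x _.
  have [B VB Bx] : (\bigcup_(A in V) A) x by rewrite coverV.
  have nBx : ~ (~` B) x by [].
  have [O [Q [oO oQ BO xQ OQ]]] :=
    @paracompact_separate_point _ x (open_closedC (openV _ VB)) nBx.
  exists Q; last exact: xQ.
  split=> //; exists B => // z clz; apply: contrapT => nBz.
  have [t [Qt Ot]] := clz _ (open_nbhs_nbhs (conj oO (BO _ nBz))).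
  by have : (O `&` Q) t by []; rewrite OQ.
move=> W [_ coverW refW lfW]; exists W; split=> // A WA.
by have [O [_ [B VB clO]] AO] := refW _ WA; exists B => // z /(closureS AO)/clO.
Qed.

Local Open Scope ring_scope.

(** A partition of unity without the normalization: sums with nonnegative
    coefficients that do not all vanish already preserve strict inequalities. *)
Lemma paracompact_bumps (R : realType) U :
  U `<=` open -> \bigcup_(A in U) A = setT ->
  exists V (phi : set T -> T -> R),
    [/\ locally_finite V,
        forall A, V A -> exists2 B, U B & A `<=` B,
        forall A, V A -> continuous (phi A) /\ (forall x, 0 <= phi A x),
        forall A x, V A -> ~ A x -> phi A x = 0 &
        forall x, exists2 A, V A & 0 < phi A x].
Proof.
move=> openU coverU.
have [V [openV coverV refV lfV]] := paracompactT openU coverU.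
have [W [lfW coverW refW]] := @paracompact_shrink V openV coverV.
(* The closed core of [A]: the cores still cover, as each member of [W] lies in
   the core of some member of [V]. *)
pose K A := \bigcup_(C in [set C | W C /\ closure C `<=` A]) closure C.
have clK A : closed (K A).
  apply: (@closed_locally_finite_closure [set C | W C /\ closure C `<=` A]) => x.
  have [N Nx finN] := lfW x; exists N => //.
  by apply: sub_finite_set finN => C [[WC _] CN].
have phiP A : exists f : T -> R, V A -> [/\ continuous f,
    forall x, 0 <= f x, forall x, ~ A x -> f x = 0 & forall x, K A x -> f x = 1].
  have [VA|nVA] := pselect (V A); last by exists (fun=> 0).
  have AK : ~` A `&` K A = set0.
    by apply/disjoints_subset => x nAx [C [_ CA] /CA].
  have /(@uniform_separatorP _ R) [f [cf f01 f0 f1]] :=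
    (@normal_separatorP R T).1 (paracompact_normal R) _ _
      (open_closedC (openV _ VA)) (clK A) AK.
  exists f => _; split => // x.
  - have /f01 : range f (f x) by exists x.
    by rewrite /= in_itv => /andP[].
  - by move=> nAx; apply: f0; exists x.
  - by move=> KAx; apply: f1; exists x.
have [phi phiE] := choice phiP.
exists V, phi; split=> //.
- by move=> A /phiE[].
- by move=> A x /phiE[_ _ + _]; exact.
- move=> x; have [C WC Cx] : (\bigcup_(A in W) A) x by rewrite coverW.
  have [A VA CA] := refW _ WC; exists A => //.
  have [_ _ _ ->] := phiE _ VA; first exact: ltr01.
  by exists C => //; exact: subset_closure.
Qed.

End Paracompact.

(** * Gluing functions that increase on fibres *)

Section Glue.
Local Open Scope ring_scope.
Variables (R : realType) (E T : topologicalType) (p : E -> T).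
Hypothesis cp : continuous p.

Lemma continuous_locally_finite_sum (V : set (set T)) (k : set T -> E -> R) :
  locally_finite V -> (forall A, V A -> continuous (k A)) ->
  (forall A e, V A -> ~ A (p e) -> k A e = 0) ->
  continuous (fun e => \sum_(A \in V) k A e).
Proof.
move=> lfV ck k0 e; have [N Npe finN] := lfV (p e).
set F := [set A | _] in finN.
have sumE (e' : E) : N (p e') ->
    \sum_(A \in V) k A e' = \sum_(A <- fset_set F) k A e'.
  move=> Npe'; rewrite -fsbig_finite //; apply/esym/fsbig_widen.
    by move=> A [].
  move=> A [VA nFA]; apply: k0 => // Ape'; apply: nFA; split => //.
  by exists (p e').
rewrite /continuous_at sumE; last exact: nbhs_singleton.
apply: (@cvg_trans _ ((fun e' => \sum_(A <- fset_set F) k A e') @ e)).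
  apply: near_eq_cvg; have : \forall e' \near e, N (p e') by exact: cp.
  by apply: filterS => e' /sumE.
have : forall A, A \in enum_fset (fset_set F) -> V A.
  by move=> A FA; have := FA; rewrite in_fset_set // => /set_mem[].
elim: (enum_fset (fset_set F)) => [|A s ih] sV.
  by under eq_fun do rewrite big_nil; rewrite big_nil; exact: cvg_cst.
under eq_fun do rewrite big_cons; rewrite big_cons.
apply: cvgD; last by apply: ih => B Bs; apply: sV; rewrite in_cons Bs orbT.
by apply: ck; apply: sV; exact: mem_head.
Qed.

(** The bound on [h] is what makes the product continuous at the points over the
    boundary of [A], where [h] may jump but [phi] vanishes. *)
Lemma continuous_bump_mul (phi : T -> R) (A : set T) (h : E -> R) :
  continuous phi -> (forall x, 0 <= phi x) ->
  (forall x, ~ A x -> phi x = 0) -> (forall e, `|h e| <= 1) ->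
  (forall e, A (p e) -> {for e, continuous h}) ->
  continuous (fun e => phi (p e) * h e).
Proof.
move=> cphi phi_ge0 phi0 h1 ch e.
have cphip : {for e, continuous (phi \o p)}.
  by apply: continuous_comp; [exact: cp|exact: cphi].
have [Ape|nApe] := pselect (A (p e)).
  by apply: (@continuousM R E); [exact: cphip|exact: ch].
have phipe : phi (p e) = 0 by exact: phi0.
rewrite /continuous_at phipe mul0r.
apply/norm_cvg0P.
apply: (@squeeze_cvgr _ _ _ _ (fun=> 0) (phi \o p)).
- near=> e'; rewrite normr_ge0 /= normrM (ger0_norm (phi_ge0 _)).
  by rewrite ler_piMr.
- exact: cvg_cst.
- by rewrite -phipe; exact: cphip.
Unshelve. all: by end_near. Qed.

(** The strictly increasing functions on an ordered fibre form a convex cone, so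
    local choices can be averaged with the bump functions: for two points [e],
    [e'] over [x], every term of the sum that does not vanish at [x] increases
    from [e] to [e'], and at least one does not vanish. *)
Lemma fiberwise_increasing_glue (U : set (set T)) (h : set T -> E -> R) :
  paracompact T -> hausdorff_space T ->
  U `<=` open -> \bigcup_(A in U) A = setT ->
  (forall A e, U A -> `|h A e| <= 1) ->
  (forall A e, U A -> A (p e) -> {for e, continuous (h A)}) ->
  exists2 g : E -> R, continuous g &
    forall e e', p e = p e' ->
      (forall A, U A -> A (p e) -> h A e < h A e') -> g e < g e'.
Proof.
move=> pcT hT openU coverU h1 ch.
have [V [phi [lfV refV phiP phi0 phi_gt0]]] := paracompact_bumps pcT hT R openU coverU.
have /choice [s sP] : forall A, exists B, V A -> U B /\ A `<=` B.
  move=> A; have [VA|nVA] := pselect (V A); last by exists set0.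
  by have [B UB AB] := refV _ VA; exists B.
have phi_ge0 A x : V A -> 0 <= phi A x by move=> /phiP[_]; exact.
exists (fun e => \sum_(A \in V) phi A (p e) * h (s A) e).
  apply: continuous_locally_finite_sum => // [A VA|A e VA nA]; last first.
    by rewrite phi0 // mul0r.
  have [UsA AsA] := sP _ VA.
  apply: (@continuous_bump_mul _ (s A)).
  - by have [] := phiP _ VA.
  - by move=> x; exact: phi_ge0.
  - by move=> x nsA; apply: phi0 => // /AsA.
  - by move=> e; exact: h1.
  - by move=> e; exact: ch.
move=> e e' pee' hlt.
have [N Nx finN] := lfV (p e).
set F := [set A | _] in finN.
have sumE (e1 : E) : p e1 = p e -> \sum_(A \in V) phi A (p e1) * h (s A) e1 =
    \sum_(A <- fset_set F) phi A (p e) * h (s A) e1.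
  move=> pe1; rewrite pe1 -fsbig_finite //; apply/esym/fsbig_widen.
    by move=> A [].
  move=> A [VA nFA]; rewrite /= phi0 ?mul0r // => Ape1; apply: nFA; split => //.
  by exists (p e); split => //; exact: nbhs_singleton.
rewrite !sumE // -subr_gt0 -sumrB.
have VF A : A \in fset_set F -> V A by rewrite in_fset_set // => /set_mem[].
have term_ge0 A : A \in fset_set F ->
    0 <= phi A (p e) * h (s A) e' - phi A (p e) * h (s A) e.
  move=> /VF VA; rewrite -mulrBr; have [Ape|nApe] := pselect (A (p e)).
    have [UsA AsA] := sP _ VA.
    by rewrite mulr_ge0 ?phi_ge0 // subr_ge0 ltW // hlt //; exact: AsA.
  by rewrite phi0 // mul0r.
have [A VA phiA] := phi_gt0 (p e).
have Ape : A (p e) by apply: contrapT => /(phi0 _ _ VA) e0; move: phiA; rewrite e0 ltxx.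
have FA : A \in fset_set F.
  rewrite in_fset_set //; apply/mem_set; split => //; exists (p e); split => //.
  exact: nbhs_singleton.
rewrite (bigD1_seq A) ?fset_uniq //= big_seq_cond.
have [UsA AsA] := sP _ VA.
rewrite ltr_pwDl ?sumr_ge0 //; last by move=> B /andP[FB _]; exact: term_ge0.
by rewrite -mulrBr mulr_gt0 // subr_gt0 hlt //; exact: AsA.
Qed.

End Glue.

(** * Embedding countable orders into the reals *)

Section OrderEmbedding.
Local Open Scope ring_scope.

(** Enumerate [D] and send [x] to the sum of [2^-(n+1)] over the indices [n] of
    the predecessors of [x] in [D].  Passing from [x] to a larger [y] keeps all
    the terms and adds at least the one of [x]. *)
Lemma countable_order_embedding (R : realType) (X : Type) (D : set X)
    (lt : X -> X -> Prop) :
  countable D -> (forall x, ~ lt x x) ->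
  (forall x y z, lt x y -> lt y z -> lt x z) ->
  exists m : X -> R,
    (forall x, `|m x| <= 1) /\ (forall x y, D x -> lt x y -> m x < m y).
Proof.
move=> /countable_injP[j jinj] ltxx lttr.
pose g (n : nat) : R := 1 / (2 ^ (n + 1))%:R.
pose u x (n : nat) : R :=
  if `[< exists y, [/\ D y, j y = n & lt y x] >] then g n else 0.
have cg : series g @ \oo --> (1 / 2 ^+ 0 : R) := cvg_geometric_series_half 1 0.
have g_gt0 n : 0 < g n by rewrite /g divr_gt0 // ltr0n expn_gt0.
have u_ge0 x n : 0 <= u x n by rewrite /u; case: ifP => // _; exact: ltW.
have u_le x n : u x n <= g n by rewrite /u; case: ifP => // _; exact: ltW.
have cu x : cvgn (series (u x)).
  apply: (@series_le_cvg _ _ g) => // [n|]; first exact: ltW.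
  by apply/cvg_ex; exists (1 / 2 ^+ 0).
have u_lt x y n : lt x y -> u x n <= u y n.
  move=> xy; rewrite {1}/u; case: asboolP => [[z [Dz jz zx]]|_] //.
  by rewrite /u asboolT //; exists z; split => //; exact: lttr xy.
have le_limu x y n : lt x y ->
    series (u y - u x) n <= limn (series (u y)) - limn (series (u x)).
  move=> xy; rewrite -lim_seriesB //; apply: nondecreasing_cvgn_le.
    by apply: nondecreasing_series => k _ _ /=; rewrite subr_ge0 u_lt.
  exact: is_cvg_seriesB.
exists (fun x => limn (series (u x))); split=> [x|x y Dx xy].
  rewrite ger0_norm; last first.
    by apply: limr_ge => //; apply: nearW => n; rewrite /series /= sumr_ge0.
  have -> : 1 = limn (series g) :> R by rewrite (cvg_lim _ cg) // expr0 divr1.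
  apply: lim_series_le => //.
  by apply/cvg_ex; exists (1 / 2 ^+ 0).
rewrite -subr_gt0; apply: lt_le_trans (le_limu _ _ (j x).+1 xy).
rewrite seriesSr ltr_wpDl //.
  by rewrite /series /= sumr_ge0 // => k _; rewrite subr_ge0 u_lt.
have uy : u y (j x) = g (j x) by rewrite /u asboolT //; exists x.
have ux : u x (j x) = 0.
  rewrite /u asboolF // => -[z [Dz jz zx]]; apply: (ltxx x).
  by rewrite -{1}(jinj z x) //; exact: mem_set.
by change (0 < u y (j x) - u x (j x)); rewrite uy ux subr0.
Qed.

End OrderEmbedding.

(** * Local constancy, pasting and sheets *)

Section LocallyConstant.
Local Open Scope ring_scope.

(** Connectedness of the line in the form of an induction principle; it replaces
    subdivisions and Lebesgue numbers in all lifting arguments. *)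
Lemma locally_constant_line (R : realType) (P : R -> Prop) :
  (forall t : R, exists2 N : set R, nbhs t N &
    forall t' t'', N t' -> N t'' -> P t' -> P t'') ->
  forall a b, P a -> P b.
Proof.
move=> locP a b Pa.
have openP (Q : R -> Prop) :
    (forall t : R, exists2 N : set R, nbhs t N &
    forall t' t'', N t' -> N t'' -> Q t' -> Q t'') ->
    open [set t | Q t].
  move=> locQ; rewrite openE => t Qt; have [N Nt NQ] := locQ t.
  have Ntt := nbhs_singleton Nt.
  by apply: filterS Nt => t' Nt'; exact: NQ Qt.
have connR : connected [set: R] by apply/connected_intervalP.
have oP := openP _ locP.
have oNP : open [set t | ~ P t].
  apply: openP => t; have [N Nt NP] := locP t; exists N => // t' t'' Nt' Nt''.
  by apply: contra_not; exact: NP.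
have PT : [set t | P t] = setT.
  apply: connR; first by exists a.
    by exists [set t | P t] => //; rewrite setTI.
  exists [set t | P t]; rewrite ?setTI //.
  by rewrite -[X in closed X]setCK; exact: open_closedC.
by have : [set t | P t] b by rewrite PT.
Qed.

Variable R : realType.
Notation I := (unit_interval R).

Lemma locally_constant_unit_interval (P : I -> Prop) :
  (forall t : I, exists2 N : set I, nbhs t N &
    forall t' t'', N t' -> N t'' -> P t' -> P t'') ->
  forall a b, P a -> P b.
Proof.
move=> locP a b; rewrite -(clampK a) -(clampK b).
apply: (@locally_constant_line R (P \o @clamp R)) => t.
have [N Nt NP] := locP (clamp t).
by exists (@clamp R @^-1` N); [exact: clamp_continuous|move=> t' t''; exact: NP].
Qed.

(** A pointwise pasting lemma: the homotopy lifts below are only known to be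
    continuous over a neighbourhood of one parameter. *)
Lemma continuous_paste_at (X T : topologicalType) (h : X -> R) (f g : X -> T) x :
  {for x, continuous h} -> (h x <= 0 -> {for x, continuous f}) ->
  (0 <= h x -> {for x, continuous g}) -> (h x = 0 -> f x = g x) ->
  {for x, continuous (fun x => if h x <= 0 then f x else g x)}.
Proof.
move=> ch cf cg fg U /=; have [hx0|hx0|hx0] := ltgtP (h x) 0.
- move=> fxU.
  have hlt : \forall y \near x, h y < 0.
    by apply: (ch [set r | r < 0]); apply: open_nbhs_nbhs; split=> //; exact: open_lt.
  have nf : \forall y \near x, U (f y) := cf (ltW hx0) U fxU.
  by apply: filterS2 hlt nf => y hy Uy; rewrite /= (ltW hy).
- move=> gxU.
  have hgt : \forall y \near x, 0 < h y.
    by apply: (ch [set r | 0 < r]); apply: open_nbhs_nbhs; split=> //; exact: open_gt.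
  have ng : \forall y \near x, U (g y) := cg (ltW hx0) U gxU.
  by apply: filterS2 hgt ng => y hy Uy; rewrite /= leNgt hy.
- move=> fxU; have gxU : nbhs (g x) U by rewrite -fg.
  have h0 : h x <= 0 by rewrite hx0.
  have h0' : 0 <= h x by rewrite hx0.
  have nf : \forall y \near x, U (f y) := cf h0 U fxU.
  have ng : \forall y \near x, U (g y) := cg h0' U gxU.
  by apply: filterS2 nf ng => y fy gy /=; case: ifP.
Qed.

End LocallyConstant.

Section Sheets.
Variables (E B : topologicalType) (p : E -> B).

(** [V] is a sheet over [U] with inverse [s], the continuity of [s] being taken in
    [B] itself, which is legitimate as [U] will always be open. *)
Definition sheet (U : set B) (V : set E) (s : B -> E) : Prop :=
  [/\ open V, forall x, V x -> U (p x) /\ s (p x) = x,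
      forall b, U b -> V (s b) /\ p (s b) = b &
      forall b, U b -> {for b, continuous s}].

Hypothesis covp : covering_map p.

Lemma covering_sheets b : exists2 U : set B, open_nbhs b U &
  exists S : set (set E),
    [/\ p @^-1` U = \bigcup_(V in S) V, trivIset S id &
        forall V, S V -> exists s, sheet U V s].
Proof.
have [_ /(_ b)[U bU [S [pU triv sheetS]]]] := covp.
exists U => //; exists S; split => // V SV.
have [oV [[fpV injp surjp] _ [s [cs sK]]]] := sheetS V SV.
exists s; split => //.
- by move=> x Vx; split; [exact: fpV|rewrite sK //; exact: mem_set].
- by move=> y Uy; have [x Vx <-] := surjp _ Uy; rewrite sK //; exact: mem_set.
- move=> y Uy; have oU : open U by have [] := bU.
  by move: cs; rewrite continuous_open_subspace // => cs; apply/cs/mem_set.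
Qed.

Lemma covering_sheet_at e :
  exists U V s, [/\ open_nbhs (p e) U, sheet U V s & V e].
Proof.
have [U bU [S [pU triv sheetS]]] := covering_sheets (p e).
have [V SV Ve] : (\bigcup_(V in S) V) e by rewrite -pU; have [] := bU.
by have [s sh] := sheetS _ SV; exists U, V, s.
Qed.

Lemma sheet_inj U V s : sheet U V s ->
  forall x y, V x -> V y -> p x = p y -> x = y.
Proof. by move=> [_ sK _ _] x y /sK[_ {2}<-] /sK[_ {2}<-] ->. Qed.

(** [E] need not be separated, but two points of a fibre are: they lie in the same
    sheet only if they are equal. *)
Lemma fiber_separated e1 e2 : p e1 = p e2 -> e1 <> e2 ->
  exists V1 V2 : set E, [/\ open V1, open V2, V1 e1, V2 e2 & V1 `&` V2 = set0].
Proof.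
move=> pe12 ne.
have [U [_ Ub] [S [pU triv sheetS]]] := covering_sheets (p e1).
have [V1 SV1 V1e1] : (\bigcup_(V in S) V) e1 by rewrite -pU.
have [V2 SV2 V2e2] : (\bigcup_(V in S) V) e2 by rewrite -pU /= -pe12.
have [s1 sh1] := sheetS _ SV1; have [s2 [oV2 _ _ _]] := sheetS _ SV2.
exists V1, V2; split => //; first by case: sh1.
apply: contrapT => /eqP/set0P V12; apply: ne.
apply: (sheet_inj sh1) => //.
by rewrite (triv _ _ SV1 SV2 V12).
Qed.

End Sheets.

(** * Lifting of paths and monodromy *)

Section Lifting.
Local Open Scope ring_scope.
Variables (R : realType) (E B : topologicalType) (p : E -> B).
Hypothesis covp : covering_map p.
Notation I := (unit_interval R).

(** Agreement of the two lifts is an open condition because [p] is injective on a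
    sheet, and a closed one because the points of a fibre are separated. *)
Lemma unique_path_lifting (a b : I -> E) :
  continuous a -> continuous b -> (forall t, p (a t) = p (b t)) ->
  forall t0 t, a t0 = b t0 -> a t = b t.
Proof.
move=> ca cb pab; apply: locally_constant_unit_interval => t.
have [ab|nab] := pselect (a t = b t).
  have [U [V [s [_ shV Ve]]]] := covering_sheet_at covp (a t).
  have [oV _ _ _] := shV.
  exists ((a @^-1` V) `&` (b @^-1` V)).
    apply: filterI; [apply: ca|apply: cb]; apply: open_nbhs_nbhs; split => //.
    by rewrite -ab.
  by move=> t' t'' _ [Vat Vbt] _; exact: (sheet_inj shV).
have [V1 [V2 [oV1 oV2 V1a V2b V12]]] := fiber_separated covp (pab t) nab.
exists ((a @^-1` V1) `&` (b @^-1` V2)).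
  by apply: filterI; [apply: ca|apply: cb]; apply: open_nbhs_nbhs; split.
move=> t' t'' [V1at V2bt] _ abt'; exfalso.
by have : (V1 `&` V2) (a t'); [split => //; rewrite /= abt'|rewrite V12].
Qed.

Lemma continuous_min_left (Y : topologicalType) (t : R) :
  continuous (fun z : R * Y => (Num.min z.1 t, z.2)).
Proof.
apply: continuous_pair2; last by move=> z; exact: cvg_snd.
apply: (@rcont_min R (R * Y)%type (fun z => z.1) (fun=> t)).
  by move=> z; exact: cvg_fst.
exact: rcont_cst.
Qed.

(** To lift a homotopy [K] near a parameter [s0], the homotopy stopped at time [t]
    is lifted for increasing [t].  Stopping it, instead of restricting it to
    times before [t], keeps the domain of all lifts the same.  Liftability
    of the stopped homotopy is a locally constant condition on [t]. *)
Section StoppedLift.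
Variables (Y : topologicalType) (K : R * Y -> B) (e0 : E) (s0 : Y).
Hypothesis cK : continuous K.
Hypothesis K0 : forall u s, u <= 0 -> K (u, s) = p e0.

Definition stopped_lift (t : R) : Prop :=
  exists2 N : set Y, nbhs s0 N & exists L : R * Y -> E,
    forall u s, N s -> [/\ {for (u, s), continuous L},
      p (L (u, s)) = K (Num.min u t, s) & u <= 0 -> L (u, s) = e0].

Lemma stopped_lift0 : stopped_lift 0.
Proof.
exists setT; first exact: filterT.
exists (fun=> e0) => u s _; split => //; first exact: cvg_cst.
by rewrite K0 // ge_min lexx orbT.
Qed.

Lemma stopped_lift_restrict t' t'' : t'' <= t' -> stopped_lift t' -> stopped_lift t''.
Proof.
move=> t''t' [N Ns0 [L LP]]; exists N => //.
exists (fun z => L (Num.min z.1 t'', z.2)) => u s Ns; split.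
- apply: (@continuous_comp _ _ _ (fun z : R * Y => (Num.min z.1 t'', z.2)) L).
    exact: continuous_min_left.
  by have [] := LP (Num.min u t'') s Ns.
- have [_ -> _] := LP (Num.min u t'') s Ns.
  by rewrite -minA (min_idPl t''t').
- by move=> u0; have [_ _ ->] := LP (Num.min u t'') s Ns; rewrite // ge_min u0.
Qed.

(** On a time interval where [K] stays over one evenly covered set, continue with
    the section [sV] of the sheet that contains the point reached at time [t']. *)
Lemma stopped_lift_extend (U : set B) (A : set R) (N0 : set Y) t' t'' :
  (forall e, U (p e) -> exists V s, sheet p U V s /\ V e) ->
  nbhs s0 N0 -> (forall u s, A u -> N0 s -> U (K (u, s))) ->
  t' <= t'' -> (forall u, t' <= u <= t'' -> A u) ->
  stopped_lift t' -> stopped_lift t''.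
Proof.
move=> sheetU Ns0 KU t't'' itvA [N1 N1s0 [L LP]].
have N1s0' := nbhs_singleton N1s0; have Ns0' := nbhs_singleton Ns0.
have At' : A t' by apply: itvA; rewrite lexx t't''.
have [V [sV [shV VL]]] : exists V s, sheet p U V s /\ V (L (t', s0)).
  apply: sheetU; have [_ -> _] := LP t' s0 N1s0'.
  by rewrite minxx; exact: KU.
have [oV sVp pVs csV] := shV.
have N2s0 : nbhs s0 [set s | V (L (t', s))].
  have [cL _ _] := LP t' s0 N1s0'.
  have : {for s0, continuous (fun s => L (t', s))}.
    apply: (@continuous_comp _ _ _ (fun s => (t', s)) L) => //.
    by apply: continuous_pair2; [exact: cst_continuous|move=> ?; exact: cvg_id].
  by apply; exact: open_nbhs_nbhs.
have sVL u s : V (L (t', s)) -> N1 s -> u = t' ->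
    L (u, s) = sV (K (Num.min u t'', s)).
  move=> VLs N1s ->; have [_ sK] := sVp _ VLs.
  by rewrite -sK; have [_ -> _] := LP t' s N1s; rewrite minxx (min_idPl t't'').
exists (N0 `&` (N1 `&` [set s | V (L (t', s))])).
  by apply: filterI => //; exact: filterI.
exists (fun z => if z.1 - t' <= 0 then L z else sV (K (Num.min z.1 t'', z.2))).
move=> u s [N0s [N1s VLs]]; have [cL pL L0] := LP u s N1s.
have Au : t' <= u -> A (Num.min u t'').
  by move=> t'u; apply: itvA; rewrite le_min t'u t't'' ge_min lexx orbT.
split=> /=.
- apply: (@continuous_paste_at R (R * Y)%type E (fun z => z.1 - t') L
    (fun z => sV (K (Num.min z.1 t'', z.2)))) => /=.
  + apply: (@rcontB R (R * Y)%type (fun z => z.1) (fun=> t')); last exact: rcont_cst.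
    by move=> z; exact: cvg_fst.
  + by [].
  + rewrite subr_ge0 => t'u.
    apply: (@continuous_comp _ _ _ (fun z : R * Y => K (Num.min z.1 t'', z.2)) sV).
      apply: (@continuous_comp _ _ _ (fun z : R * Y => (Num.min z.1 t'', z.2)) K).
        exact: continuous_min_left.
      exact: cK.
    by apply: csV; apply: KU => //; exact: Au.
  + by move=> /eqP; rewrite subr_eq0 => /eqP; exact: sVL.
- rewrite subr_le0; case: (leP u t') => [ut'|t'u].
    by rewrite pL (min_idPl ut') (min_idPl (le_trans ut' t't'')).
  by have [_ ->] := pVs _ (KU _ _ (Au (ltW t'u)) N0s).
(* Times in between [t'] and [0]: the section returns the starting point, since
   the constant lift passes through the sheet. *)
- rewrite subr_le0; case: (leP u t') => [_|t'u u0]; first exact: L0.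
  have t'0 : t' <= 0 by apply: ltW; exact: lt_le_trans u0.
  have [_ _ /(_ t'0) Lt'] := LP t' s N1s.
  rewrite K0; last by rewrite ge_min u0.
  by have [_] := sVp _ VLs; rewrite Lt'.
Qed.

Lemma stopped_lift1 : stopped_lift 1.
Proof.
apply: (@locally_constant_line R stopped_lift _ 0 1 stopped_lift0) => t.
have [U [oU Ut] [S [pU _ sheetS]]] := covering_sheets covp (K (t, s0)).
have sheetU e : U (p e) -> exists V s, sheet p U V s /\ V e.
  move=> Ue; have [V SV Ve] : (\bigcup_(V in S) V) e by rewrite -pU.
  by have [s sh] := sheetS _ SV; exists V, s.
have [[A N] [/= At Ns0] AN] : nbhs (t, s0) (K @^-1` U).
  by apply: cK; exact: open_nbhs_nbhs.
have [e /= e0' ballA] := (nbhs_ballP t A).1 At.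
exists (ball t e); first exact: nbhsx_ballx.
move=> t' t'' Bt' Bt''; have [t''t'|t't''] := leP t'' t'.
  exact: stopped_lift_restrict.
apply: (@stopped_lift_extend U A N) => //.
- by move=> u s Au Ns; exact: (AN (u, s)).
- exact: ltW.
- move=> u /andP[t'u ut'']; apply: ballA.
  move: Bt' Bt''; rewrite /ball /= !ltr_distlC => /andP[l1 _] /andP[_ l2].
  by apply/andP; split; [exact: lt_le_trans t'u|exact: le_lt_trans l2].
Qed.

End StoppedLift.

(** With a constant homotopy this is the lifting of paths; in general the lift is
    only found locally in the parameter, which is all that the monodromy
    theorem needs. *)
Lemma tube_lifting (Y : topologicalType) (H : I * Y -> B) (e0 : E) (s0 : Y) :
  continuous H -> (forall s, H (zero, s) = p e0) ->
  exists2 N : set Y, nbhs s0 N & exists L : I * Y -> E,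
    forall t s, N s -> [/\ {for (t, s), continuous L},
      p (L (t, s)) = H (t, s) & L (zero, s) = e0].
Proof.
move=> cH H0; pose K (z : R * Y) := H (clamp z.1, z.2).
have cK : continuous K.
  apply: (@continuous_comp2 _ _ _ (fun z : R * Y => (clamp z.1, z.2)) H) => //.
  apply: continuous_pair2; last by move=> z; exact: cvg_snd.
  by apply: continuous_clamp => z; exact: cvg_fst.
have K0 u s : u <= 0 -> K (u, s) = p e0 by move=> u0; rewrite /K clamp_le0.
have [N Ns0 [L LP]] := @stopped_lift1 Y K e0 s0 cK K0.
exists N => //; exists (fun z => L (ival z.1, z.2)) => t s Ns.
have [cL pL L0] := LP (ival t) s Ns; have /andP[t0 t1] := ival_itv t.
split=> /=.
- apply: (@continuous_comp _ _ _ (fun z : I * Y => (ival z.1, z.2)) L) => //.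
  apply: continuous_pair2; last by move=> z; exact: cvg_snd.
  apply: (@continuous_comp2 _ _ _ fst (@ival R)); last exact: ival_continuous.
  by move=> z; exact: cvg_fst.
- by rewrite pL (min_idPl t1) /K /= clampK.
- by have [_ _ ->] := LP (ival zero) s Ns; rewrite ?ival0.
Qed.

Lemma path_lifting (x y : B) (a : {path I from x to y in B}) (e : E) : p e = x ->
  exists e' (b : {path I from e to e' in E}), forall t, p (b t) = a t.
Proof.
move=> pe.
have ca : continuous (fun z : I * I => a z.1).
  by apply: (@continuous_comp2 _ _ _ fst a);
    [move=> z; exact: cvg_fst|exact: cts_fun].
have [|N N0 [L LP]] := @tube_lifting I _ e zero ca.
  by move=> s /=; rewrite path_zero.
have LN t := LP t zero (nbhs_singleton N0).
have cb : continuous (fun t => L (t, zero)).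
  move=> t; apply: (@continuous_comp _ _ _ (fun t => (t, zero)) L).
    by apply: continuous_pair2; [move=> ?; exact: cvg_id|exact: cst_continuous].
  by have [] := LN t.
have b0 : L (zero, zero) = e by have [] := LN zero.
exists (L (one, zero)), (mk_path cb b0 erefl) => t.
by have [_ /= pL _] := LN t; exact: pL.
Qed.

(** Paths from [e0] whose images are homotopic relative to the endpoints end at
    the same point: the endpoint of the lift of the path at stage [s] of the
    homotopy varies continuously in the discrete fibre, so it does not move. *)
Lemma monodromy (e0 e1 e2 : E) (a : {path I from e0 to e1 in E})
    (b : {path I from e0 to e2 in E}) (H : I * I -> B) :
  continuous H -> (forall t, H (t, zero) = p (a t)) ->
  (forall t, H (t, one) = p (b t)) -> (forall s, H (zero, s) = p e0) ->
  (forall s, H (one, s) = p e1) -> e1 = e2.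
Proof.
move=> cH Ha Hb H0 H1.
(* By uniqueness of lifts, [P s] says that the lift at stage [s] ends at [e1]. *)
pose P (s : I) := exists c : I -> E, [/\ continuous c, c zero = e0, c one = e1 &
  forall t, p (c t) = H (t, s)].
suff [c [cc c0 c1 pc]] : P one.
  rewrite -c1 -[RHS](@path_one _ _ _ _ b).
  apply: (@unique_path_lifting c b _ _ _ zero) => //.
  - exact: cts_fun.
  - by move=> t; rewrite pc Hb.
  - by rewrite path_zero.
have P0 : P zero.
  by exists a; rewrite path_zero path_one; split => //; exact: cts_fun.
apply: (@locally_constant_unit_interval R P _ zero one P0) => s0.
have [N Ns0 [L LP]] := @tube_lifting I H e0 s0 cH H0.
have [U [V [sV [_ shV VL]]]] := covering_sheet_at covp (L (one, s0)).
have [oV _ _ _] := shV.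
have cLs s : N s -> continuous (fun t => L (t, s)).
  move=> Ns t; apply: (@continuous_comp _ _ _ (fun t => (t, s)) L).
    by apply: continuous_pair2; [move=> ?; exact: cvg_id|exact: cst_continuous].
  by have [] := LP t s Ns.
exists (N `&` [set s | V (L (one, s))]).
  apply: filterI => //; have [cL _ _] := LP one s0 (nbhs_singleton Ns0).
  have : {for s0, continuous (fun s => L (one, s))}.
    apply: (@continuous_comp _ _ _ (fun s => (one, s)) L) => //.
    by apply: continuous_pair2; [exact: cst_continuous|move=> ?; exact: cvg_id].
  by apply; exact: open_nbhs_nbhs.
move=> s' s'' [Ns' Vs'] [Ns'' Vs''] [c [cc c0 c1 pc]].
have Ls' : L (one, s') = e1.
  rewrite -c1; apply: (@unique_path_lifting (fun t => L (t, s')) c _ _ _ zero) => //.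
  - exact: cLs.
  - by move=> t; have [_ -> _] := LP t s' Ns'.
  - by rewrite c0; have [] := LP zero s' Ns'.
exists (fun t => L (t, s'')); split.
- exact: cLs.
- by have [] := LP zero s'' Ns''.
- rewrite -Ls'; apply: (sheet_inj shV) => //.
  have [_ -> _] := LP one s'' Ns''; have [_ -> _] := LP one s' Ns'.
  by rewrite !H1.
- by move=> t; have [_ -> _] := LP t s'' Ns''.
Qed.

End Lifting.

(** * Cancellation in the fundamental groupoid *)

Section PathAlgebra.
Variables (R : realType) (T : topologicalType).
Notation I := (unit_interval R).
Notation path x y := {path I from x to y in T}.

#[local] Instance path_homotopic_equivalence x y :
  RelationClasses.Equivalence (@path_homotopic R T x y).
Proof.
split; [exact: path_homotopic_refl|exact: path_homotopic_sym|].
by move=> a b c; exact: path_homotopic_trans.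
Qed.

#[local] Instance path_concat_proper x y z :
  Morphisms.Proper (Morphisms.respectful (@path_homotopic R T x y)
    (Morphisms.respectful (@path_homotopic R T y z) (@path_homotopic R T x z)))
    (@path_concat R T x y z).
Proof. by move=> a a' aa' b b' bb'; exact: path_homotopic_concat. Qed.

Lemma path_concatK x y z (a : path x y) (b : path y z) :
  path_homotopic (path_concat (path_concat a b) (path_reverse b)) a.
Proof.
by rewrite -path_concatA path_concatpV path_concatp1;
exact: path_homotopic_refl.
Qed.

Lemma path_concatKV x y z (a : path x y) (b : path z y) :
  path_homotopic (path_concat (path_concat a (path_reverse b)) b) a.
Proof.
by rewrite -path_concatA path_concatVp path_concatp1;
exact: path_homotopic_refl.
Qed.

Lemma path_concatI x y z (a a' : path x y) (b : path y z) :
  path_homotopic (path_concat a b) (path_concat a' b) -> path_homotopic a a'.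
Proof.
move=> ab; apply: path_homotopic_trans (path_homotopic_sym (path_concatK a b)) _.
by rewrite ab path_concatK; exact: path_homotopic_refl.
Qed.

Variable b0 : T.

(** The effect on the loop [u . c] of changing the return path [c] is a right
    translation, and that of changing the outgoing path [u] is a left one. *)
Lemma loop_class_changer x (u : path b0 x) (c c' : path x b0) :
  loop_class (path_concat u c') =
  (loop_class (path_concat u c) * loop_class (path_concat (path_reverse c) c'))%g.
Proof.
transitivity (pi1_mul (loop_class (path_concat u c))
   (loop_class (path_concat (path_reverse c) c'))) => //.
by rewrite pi1_mulE; apply/loop_classP; rewrite path_concatA path_concatK;
  exact: path_homotopic_refl.
Qed.

Lemma loop_class_changel x (u v : path b0 x) (c : path x b0) :
  loop_class (path_concat u c) =
  (loop_class (path_concat u (path_reverse v)) * loop_class (path_concat v c))%g.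
Proof.
transitivity (pi1_mul (loop_class (path_concat u (path_reverse v)))
   (loop_class (path_concat v c))) => //.
by rewrite pi1_mulE; apply/loop_classP; rewrite path_concatA path_concatKV;
  exact: path_homotopic_refl.
Qed.

End PathAlgebra.

(** * Fibres as sets of cosets *)

Section CosetOrders.
Variables (G : groupType) (H : set G).

(** Orders on the set of cosets are handled as relations between subsets of [G],
    which avoids carrying the proofs that these subsets are cosets. *)
Lemma orderable_cosetsP : orderable (coset_gset H) <->
  exists lt : set G -> set G -> Prop,
    [/\ forall A, ~ lt A A,
        forall A A' A'', lt A A' -> lt A' A'' -> lt A A'',
        forall g g', right_coset H g <> right_coset H g' ->
          lt (right_coset H g) (right_coset H g') \/
          lt (right_coset H g') (right_coset H g) &
        forall A A' k, lt A A' -> lt (rtranslate A k) (rtranslate A' k)].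
Proof.
split=> [[R [invR transR irrR _ totR]]|[lt [irr trans tot inv]]].
  exists (fun A A' => exists C C' : coset_gset H,
    [/\ \val C = A, \val C' = A' & R (C, C')]); split.
  - move=> A [C [C' [<- /val_inj ->]] RC].
    by have : (R `&` diagonal) (C, C) by []; rewrite irrR.
  - move=> A A' A'' [C [C' [CA C'A' RC]]] [D [D' [DA' D'A'' RD]]].
    exists C, D'; split => //; apply: transR; exists C' => //=.
    by have <- : D = C' by apply: val_inj; rewrite DA'.
  - move=> g g' ne.
    have mk k : exists C : coset_gset H, \val C = right_coset H k.
      have kH : right_coset H k \in right_cosets H by apply/mem_set; exists k.
      by exists (exist (fun A => A \in right_cosets H) _ kH).
    have [C CE] := mk g; have [C' C'E] := mk g'.
    have : (~` diagonal) (C, C').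
      by move=> CC'; apply: ne; rewrite -CE -C'E; congr (\val _); exact: CC'.
    by rewrite -totR => -[RC|RC]; [left; exists C, C'|right; exists C', C].
  - move=> _ _ k [C [C' [<- <- RC]]].
    by exists (coset_ract C k), (coset_ract C' k); split => //; exact: invR.
exists [set CC | lt (\val CC.1) (\val CC.2)]; split.
- by move=> C C' k /= /inv; exact.
- by move=> [C C''] [C' /= /trans]; exact.
- by apply/seteqP; split => // -[C C'] [+ CC']; rewrite /= -[C'](CC' : C = C') => /irr.
- by apply/seteqP; split => // -[C C'] [/= CC' /(trans _ _ _ CC')/irr].
- apply/seteqP; split => [[C C'] [] CC' EC|[C C'] ne].
  + by move: CC'; rewrite /= -[C'](EC : C = C') => /irr.
  + by move: CC'; rewrite /= -[C'](EC : C = C') => /irr.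
  have [g _ gC] := set_mem (valP C); have [g' _ gC'] := set_mem (valP C').
  have := tot g g'; rewrite gC gC'; apply => /val_inj; exact: ne.
Qed.

End CosetOrders.

Section Holonomy.
Variables (R : realType) (E B : topologicalType) (p : continuousType E B).
Notation I := (unit_interval R).
Notation path x y := {path I from x to y in _}.

Section PushPath.
Variables (e e' : E) (x y : B) (a : path e e') (pe : p e = x) (pe' : p e' = y).

Lemma push_path_continuous : continuous (p \o a).
Proof. by move=> t; apply: continuous_comp; exact: cts_fun. Qed.

Lemma push_path0 : (p \o a) zero = x.
Proof. by rewrite /= path_zero. Qed.

Lemma push_path1 : (p \o a) one = y.
Proof. by rewrite /= path_one. Qed.

Definition push_path : {path I from x to y in B} :=
  mk_path push_path_continuous push_path0 push_path1.

End PushPath.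

Lemma push_path_concat e e' e'' x y z (a : path e e') (b : path e' e'')
    (pe : p e = x) (pe' : p e' = y) (pe'' : p e'' = z) :
  push_path (path_concat a b) pe pe'' =
  path_concat (push_path a pe pe') (push_path b pe' pe'').
Proof.
apply/path_eqP => t; rewrite path_concatE /push_path /= /mk_path /=.
by rewrite /concat_fun; case: ifP.
Qed.

Lemma push_path_reverse e e' x y (a : path e e') (pe : p e = x) (pe' : p e' = y) :
  push_path (path_reverse a) pe' pe = path_reverse (push_path a pe pe').
Proof. by apply/path_eqP. Qed.

Variables (b0 : B) (e0 : E) (pe0 : p e0 = b0).
Notation G := (pi1 R b0).
Notation H := (range (pi1_map R p pe0)).

Lemma pi1_map_push (d : path e0 e0) :
  pi1_map R p pe0 (loop_class d) = loop_class (push_path d pe0 pe0).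
Proof. by rewrite pi1_mapE; congr loop_class; apply/path_eqP. Qed.

(** The classes of the loops that project a path from [e0] to [e] and return to
    [b0] along [c].  It is a right coset of the image of the fundamental group
    of [E], and for fixed [c] this identifies the fibre over [x] with the set
    of cosets without choosing lifts; a point [e] outside the fibre over [x]
    gets the empty set. *)
Definition holonomy (e : E) (x : B) (c : {path I from x to b0 in B}) : set G :=
  [set g | exists (a : {path I from e0 to e in E}) (pe : p e = x),
     g = loop_class (path_concat (push_path a pe0 pe) c)].

Hypothesis covp : covering_map p.
Hypothesis pcE : path_connected R E.

Lemma path_to (e e' : E) : exists a : {path I from e to e' in E}, True.
Proof. by have [_ /(_ e e' Logic.I Logic.I)[a _]] := pcE; exists a. Qed.

Lemma holonomy_nonempty e x (c : {path I from x to b0 in B}) :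
  p e = x -> holonomy e c !=set0.
Proof. by move=> pe; have [a _] := path_to e0 e; eexists; exists a, pe. Qed.

(** Two paths from [e0] to [e] differ by a loop of [E] at [e0]. *)
Lemma holonomy_cosetE e x (c : {path I from x to b0 in B}) g :
  holonomy e c g -> holonomy e c = right_coset H g.
Proof.
move=> [a [pe ->]]; apply/seteqP; split.
  move=> _ [a' [pe' ->]]; rewrite (Prop_irrelevance pe' pe).
  rewrite (loop_class_changel (push_path a' pe0 pe) (push_path a pe0 pe)).
  rewrite -push_path_reverse -push_path_concat -pi1_map_push.
  by set h := pi1_map _ _ _ _; exists h.
move=> _ [_ [h _ <-] <-]; have [d ->] := loop_class_surj h.
exists (path_concat d a), pe; rewrite pi1_map_push (push_path_concat _ _ pe0 pe0 pe).
transitivity (pi1_mul (loop_class (push_path d pe0 pe0))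
   (loop_class (path_concat (push_path a pe0 pe) c))) => //.
by rewrite pi1_mulE; apply/loop_classP; exact: path_concatA.
Qed.

Lemma holonomy_coset e x (c : {path I from x to b0 in B}) :
  p e = x -> exists g, holonomy e c = right_coset H g.
Proof.
by move=> pe; have [g eg] := holonomy_nonempty c pe; exists g; exact: holonomy_cosetE.
Qed.

Lemma holonomy_eq e e' x y (c : {path I from x to b0 in B})
    (c' : {path I from y to b0 in B}) g :
  holonomy e c g -> holonomy e' c' g -> holonomy e c = holonomy e' c'.
Proof. by move=> /holonomy_cosetE -> /holonomy_cosetE ->. Qed.

(** Changing the return path moves the cosets of all points of the fibre by the
    same element of [G]; hence an invariant order of the cosets orders every
    fibre, independently of [c]. *)
Lemma holonomy_rtranslate e x (c c' : {path I from x to b0 in B}) :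
  p e = x ->
  holonomy e c' =
  rtranslate (holonomy e c) (loop_class (path_concat (path_reverse c) c')).
Proof.
move=> pe; have [a _] := path_to e0 e.
have gc : holonomy e c (loop_class (path_concat (push_path a pe0 pe) c)).
  by exists a, pe.
rewrite (holonomy_cosetE gc) rtranslate_coset -loop_class_changer.
by apply: holonomy_cosetE; exists a, pe.
Qed.

(** Moving a point along a lift of [d] prepends [d] to the return path: this is
    why the orders of neighbouring fibres agree along the sheets. *)
Lemma holonomy_transport e e' x y (d : {path I from x to y in B})
    (c : {path I from y to b0 in B}) (b : path e e') :
  p e = x -> p e' = y -> (forall t, p (b t) = d t) ->
  holonomy e' c = holonomy e (path_concat d c).
Proof.
move=> pe pe' pb; have [a _] := path_to e0 e.
apply: (@holonomy_eq _ _ _ _ _ _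
  (loop_class (path_concat (push_path (path_concat a b) pe0 pe') c))).
  by exists (path_concat a b), pe'.
exists a, pe; rewrite (push_path_concat _ _ pe0 pe pe').
have -> : push_path b pe pe' = d by apply/path_eqP => t; exact: pb.
by apply/loop_classP/path_homotopic_sym; exact: path_concatA.
Qed.

(** This is where monodromy enters: a common element of the two cosets gives paths
    to [e] and [e'] with homotopic images. *)
Lemma holonomy_inj e e' x (c : {path I from x to b0 in B}) :
  p e = x -> p e' = x -> holonomy e c = holonomy e' c -> e = e'.
Proof.
move=> pe pe' ee'; have [g] := holonomy_nonempty c pe.
move=> /[dup]; rewrite {1}ee' => -[a' [qe' ->]] [a [qe]].
move=> /loop_classP/path_concatI/path_homotopic_sym[K [cK K0 K1 Kx Ky]].
apply: (monodromy covp (a := a) (b := a') cK) => //.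
- by move=> s; rewrite Kx.
- by move=> s; rewrite Ky.
Qed.

Lemma holonomy_surj g : exists2 e, p e = b0 &
  holonomy e (path_const R b0) = right_coset H g.
Proof.
have [a ->] := loop_class_surj g.
have [e [b pb]] := path_lifting covp a pe0.
have pe : p e = b0 by rewrite -[e](@path_one _ _ _ _ b) pb path_one.
exists e => //; apply: holonomy_cosetE; exists b, pe.
have -> : push_path b pe0 pe = a by apply/path_eqP => t; exact: pb.
by apply/loop_classP/path_homotopic_sym; exact: path_concatp1.
Qed.

(** The monodromy action of [k] on the fibre over [b0] is the right translation
    of cosets. *)
Lemma holonomy_act e e' (k : {path I from b0 to b0 in B}) (b : path e e') :
  p e = b0 -> p e' = b0 -> (forall t, p (b t) = k t) ->
  holonomy e' (path_const R b0) =
  rtranslate (holonomy e (path_const R b0)) (loop_class k).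
Proof.
move=> pe pe' pb; rewrite (holonomy_transport _ pe pe' pb).
rewrite (holonomy_rtranslate (path_const R b0) _ pe); congr rtranslate.
apply/loop_classP.
have -> : path_reverse (path_const R b0) = path_const R b0 by apply/path_eqP.
apply: path_homotopic_trans (path_concat1p _) _; exact: path_concatp1.
Qed.

End Holonomy.

(** * Invariant orders and embeddings *)

Section SheetRetraction.
Variables (R : realType) (E B : topologicalType) (p : E -> B).
Notation I := (unit_interval R).
Hypothesis covp : covering_map p.
Hypothesis lpcB : locally_path_connected R B.

(** Over a path connected open set inside an evenly covered one, [r] pushes every
    point along its sheet to the fibre over the centre [x].  The same path [d]
    of the base is lifted for all points of a fibre, so that [r] will be seen to
    preserve their order. *)
Lemma sheet_retraction (x : B) : exists U (r : E -> E),
  [/\ open_nbhs x U, forall e, U (p e) -> p (r e) = x,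
      forall e, U (p e) -> \forall e' \near e, r e' = r e &
      forall b, U b -> exists d : {path I from b to x in B}, forall e, p e = b ->
        exists c : {path I from e to r e in E}, forall t, p (c t) = d t].
Proof.
have [U0 [oU0 U0x] [S [pU0 triv sheetS]]] := covering_sheets covp x.
have [_ /(_ x)/(_ U0 (open_nbhs_nbhs (conj oU0 U0x)))[U [[oU pcU] Ux] UU0]] := lpcB.
pose in_sheet e e' := exists V, [/\ S V, V e, V e' & p e' = x].
have /choice[r rP] : forall e, exists e', U (p e) -> in_sheet e e'.
  move=> e; have [Upe|] := pselect (U (p e)); last by exists e.
  have [V SV Ve] : (\bigcup_(V in S) V) e by rewrite -pU0; exact: UU0.
  have [s [_ _ sU0 _]] := sheetS V SV; have [Vs ps] := sU0 x U0x.
  by exists (s x) => _; exists V.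
exists U, r; split => //.
- by move=> e /rP[V []].
- move=> e Upe; have [V [SV Ve Vr pr]] := rP e Upe.
  have [s sh] := sheetS V SV; have [oV _ _ _] := sh.
  have nV : nbhs e V by exact: open_nbhs_nbhs.
  have nU : nbhs e (p @^-1` U).
    by have [cp _] := covp; apply: cp; exact: open_nbhs_nbhs.
  apply: filterS2 nV nU => e' Ve' Upe'; have [V' [SV' V'e' V'r pr']] := rP e' Upe'.
  have VV' : V = V' by apply: triv => //; exists e'.
  by apply: (sheet_inj sh); rewrite ?pr ?pr' // VV'.
- move=> b Ub; have [d dU] := pcU b x Ub Ux; exists d => e pe.
  have Upe : U (p e) by rewrite pe.
  have [V [SV Ve Vr pr]] := rP e Upe.
  have [s [_ sV sU0 cs]] := sheetS V SV.
  have csd : continuous (s \o d).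
    move=> t; apply: continuous_comp; first exact: cts_fun.
    by apply: cs; apply: UU0.
  have sd0 : (s \o d) zero = e by rewrite /= path_zero -pe; have [] := sV e Ve.
  have sd1 : (s \o d) one = r e.
    by rewrite /= path_one -pr; have [] := sV (r e) Vr.
  exists (mk_path csd sd0 sd1) => t; rewrite /mk_path /=.
  by have [] := sU0 _ (UU0 _ (dU t)).
Qed.

End SheetRetraction.

Section Main.
Local Open Scope ring_scope.
Variables (R : realType) (E B : topologicalType) (p : continuousType E B).
Variables (b0 : B) (e0 : E) (pe0 : p e0 = b0).
Notation I := (unit_interval R).
Notation G := (pi1 R b0).
Notation H := (range (pi1_map R p pe0)).
Hypothesis covp : covering_map p.
Hypothesis pcE : path_connected R E.

(** The invariant order of the cosets gives an order on each fibre.  Over a small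
    open set, retract onto one fibre and embed that fibre, which is countable,
    increasingly into [R]; then glue these functions. *)
Lemma orderable_bundle_embedding :
  hausdorff_space B -> paracompact B -> path_connected R B ->
  locally_path_connected R B -> countable [set: G] ->
  orderable (coset_gset H) -> exists f : E -> R * B, bundle_embedding p f.
Proof.
move=> hB pB [_ pcB] lpcB cG /orderable_cosetsP[lt [irr trans tot inv]].
have cH : countable (right_cosets H).
  exact: (card_le_trans (card_image_le _ _) cG).
have [m [m1 mlt]] := countable_order_embedding R cH irr trans.
pose hol e x (c : {path I from x to b0 in B}) := holonomy pe0 e c.
(* Two points are compared along some return path; [fibre_ltE] shows that all
   return paths then agree. *)
pose fibre_lt e e' := exists x (c : {path I from x to b0 in B}),
  [/\ p e = x, p e' = x & lt (hol e x c) (hol e' x c)].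
have fibre_ltE e e' x (c : {path I from x to b0 in B}) :
    p e = x -> fibre_lt e e' -> lt (hol e x c) (hol e' x c).
  move=> pe [y [c' [pe1 pe' ltc]]].
  have yx : y = x by rewrite -pe1.
  move: c' pe1 pe' ltc; rewrite yx => c' _ pe' ltc.
  rewrite /hol (holonomy_rtranslate pe0 pcE c' c pe).
  by rewrite (holonomy_rtranslate pe0 pcE c' c pe'); exact: inv.
have fibre_tot e e' : p e = p e' -> e <> e' -> fibre_lt e e' \/ fibre_lt e' e.
  move=> pee' ne; have [c _] := pcB (p e) b0 Logic.I Logic.I.
  have [g gE] := holonomy_coset pe0 pcE c erefl.
  have [g' g'E] := holonomy_coset pe0 pcE c (esym pee').
  have : right_coset H g <> right_coset H g'.
    by rewrite -gE -g'E => /(holonomy_inj covp pcE erefl (esym pee')).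
  move=> /tot; rewrite -gE -g'E => -[ltc|ltc]; [left|right];
  by exists (p e), c.
pose good U (h : E -> R) := [/\ forall e, `|h e| <= 1,
  forall e, U (p e) -> {for e, continuous h} &
  forall e e', p e = p e' -> U (p e) -> fibre_lt e e' -> h e < h e'].
pose cover := [set U | open U /\ exists h, good U h].
have coverT : \bigcup_(U in cover) U = setT.
  apply/seteqP; split => // x _.
  have [U [r [[oU Ux] pr rnear rpath]]] := sheet_retraction covp lpcB x.
  exists U => //; split => //.
  have [c _] := pcB x b0 Logic.I Logic.I.
  exists (fun e => m (hol (r e) x c)); split => //.
    move=> e /rnear re; apply: (@cvg_trans _ (cst (m (hol (r e) x c)) @ e)).
      by apply: near_eq_cvg; apply: filterS re => e' /= ->.
    exact: cvg_cst.
  move=> e e' pee' Upe ltee'; have [d dP] := rpath _ Upe.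
  have holr e1 : p e1 = p e -> hol (r e1) x c = hol e1 (p e) (path_concat d c).
    move=> pe1; have [b pb] := dP e1 pe1.
    by apply: (holonomy_transport pe0 pcE) pb => //; apply: pr; rewrite pe1.
  rewrite !holr //; apply: mlt; last exact: fibre_ltE.
  have [g gE] := holonomy_coset pe0 pcE (path_concat d c) (erefl (p e)).
  by rewrite /hol gE; exists g.
have /choice[h hP] : forall U, exists h, cover U -> good U h.
  move=> U; have [[_ [h gh]]|nU] := pselect (cover U); first by exists h.
  by exists (fun=> 0).
have [|||A e /hP[+ _ _]|A e /hP[_ + _]|g cg gP] :=
  @fiberwise_increasing_glue R E B p _ cover h pB hB.
- by move=> e; exact: cts_fun.
- by move=> U [].
- by [].
- exact.
- exact.
have g_lt e e' : p e = p e' -> fibre_lt e e' -> g e < g e'.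
  move=> pee' ltee'; apply: gP => // A /hP[_ _ hA] Ape; exact: hA.
exists (fun e => (g e, p e)); split.
- by apply: continuous_pair2 => // e; exact: cts_fun.
- move=> e e' [gee' pee']; apply: contrapT => ne.
  have [/(g_lt _ _ pee')|/(g_lt _ _ (esym pee'))] := fibre_tot _ _ pee' ne;
  by rewrite gee' ltxx.
- by [].
Qed.

(** The height in [R] orders the fibre over [b0].  Along the lifts of a loop from
    two different points of the fibre the heights are never equal, by unique
    lifting and injectivity of the embedding, so their order cannot change:
    the order is invariant under monodromy. *)
Lemma bundle_embedding_orderable :
  (exists f : E -> R * B, bundle_embedding p f) -> orderable (coset_gset H).
Proof.
move=> [f [cf injf fp]]; apply/orderable_cosetsP.
pose h e := (f e).1.
have ch : continuous h.
  by apply: (continuous_comp2 cf); move=> z; exact: cvg_fst.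
have fE e : f e = (h e, p e) by rewrite -fp /h /=; case: (f e).
have h_inj e e' : p e = p e' -> h e = h e' -> e = e'.
  by move=> pee' hee'; apply: injf; rewrite !fE pee' hee'.
pose hol e := holonomy pe0 e (path_const R b0).
have hol_inj e e' : p e = b0 -> p e' = b0 -> hol e = hol e' -> e = e'.
  exact: holonomy_inj.
exists (fun A A' => exists e e',
  [/\ p e = b0, p e' = b0, A = hol e, A' = hol e' & h e < h e']); split.
- move=> A [e [e' [pe pe' -> /(hol_inj _ _ pe pe') ->]]].
  by rewrite ltxx.
- move=> _ _ _ [e [e1 [pe pe1 -> -> lt1]]] [e2 [e3 [pe2 pe3 e12 -> lt2]]].
  exists e, e3; split => //; apply: lt_trans lt1 _.
  by rewrite (hol_inj _ _ pe1 pe2 e12).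
- move=> g g' ne; have [e pe eE] := holonomy_surj pe0 covp g.
  have [e' pe' e'E] := holonomy_surj pe0 covp g'.
  have [lt|lt|eq] := ltgtP (h e) (h e').
  + by left; exists e, e'.
  + by right; exists e', e.
  + by case: ne; rewrite -eE -e'E (h_inj e e') // pe pe'.
move=> _ _ g [e [e' [pe pe' -> -> hlt]]].
have [k ->] := loop_class_surj g.
have [e1 [c pc]] := path_lifting covp k pe.
have [e1' [c' pc']] := path_lifting covp k pe'.
have pe1 : p e1 = b0 by rewrite -[e1](@path_one _ _ _ _ c) pc path_one.
have pe1' : p e1' = b0 by rewrite -[e1'](@path_one _ _ _ _ c') pc' path_one.
exists e1, e1'; split => //.
- by rewrite -(holonomy_act pe0 pcE pe pe1 pc).
- by rewrite -(holonomy_act pe0 pcE pe' pe1' pc').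
rewrite -[e1](@path_one _ _ _ _ c) -[e1'](@path_one _ _ _ _ c').
have cc : continuous c by exact: cts_fun.
have cc' : continuous c' by exact: cts_fun.
have hc t : h (c t) <> h (c' t).
  have pcc' t' : p (c t') = p (c' t') by rewrite pc pc'.
  move=> /(h_inj _ _ (pcc' t)) cct.
  have := unique_path_lifting covp cc cc' pcc' zero cct.
  by rewrite !path_zero => ee'; move: hlt; rewrite ee' ltxx.
pose D t := h (c' t) - h (c t).
have cD : continuous D.
  by apply: rcontB; [exact: (continuous_comp2 cc')|exact: (continuous_comp2 cc)].
have D0 : 0 < D zero by rewrite /D !path_zero subr_gt0.
rewrite -subr_gt0 -/(D one).
apply: (@locally_constant_unit_interval R (fun t => 0 < D t) _ zero one D0) => t.
have [Dt|Dt|Dt] := ltgtP 0 (D t).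
- exists (D @^-1` [set r | 0 < r]); last by move=> t' t''.
  by apply: cD; apply: open_nbhs_nbhs; split => //; exact: open_gt.
- exists (D @^-1` [set r | r < 0]).
    by apply: cD; apply: open_nbhs_nbhs; split => //; exact: open_lt.
  by move=> t' t'' /= /lt_trans + _ => /[apply]; rewrite ltxx.
- by case: (hc t); apply/eqP; rewrite eq_sym -subr_eq0 -/(D t) -Dt.
Qed.

End Main.

Lemma orderable_trivial_cosets (G : groupType) :
  orderable (coset_gset [set 1%g : G]) <-> right_orderable G.
Proof.
have coset1 (g : G) : right_coset [set 1%g] g = [set g].
  apply/seteqP; split => [_ [_ -> <-]|_ ->]; first by rewrite mul1g.
  by exists 1%g; rewrite ?mul1g.
have translate1 (g k : G) : rtranslate [set g] k = [set (g * k)%g].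
  apply/seteqP; split => [_ [_ -> <-] //|_ ->].
  by exists g.
split=> [/orderable_cosetsP[lt [irr trans tot inv]]|[lt [irr trans tot inv]]].
  exists (fun g h => lt [set g] [set h]); split => //.
  - by move=> g h k; exact: trans.
  - move=> g h ne; have := tot g h; rewrite !coset1; apply => gh; apply: ne.
    by have : [set h] g by rewrite -gh.
  - by move=> k g h /(inv _ _ k); rewrite !translate1.
apply/orderable_cosetsP.
exists (fun A A' => exists g g', [/\ A = [set g], A' = [set g'] & lt g g']).
have set1_inj (g h : G) : [set g] = [set h] -> g = h.
  by move=> gh; have : [set h] g by rewrite -gh.
split.
- by move=> A [g [g' [-> /set1_inj -> /irr]]].
- move=> _ _ _ [g [g' [-> -> gg']]] [h [h' [/set1_inj g'h -> hh']]].
  by exists g, h'; split => //; apply: trans gg' _; rewrite g'h.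
- move=> g g'; rewrite !coset1 => ne.
  have [|gg'|g'g] := tot g g'; first by move=> gg'; apply: ne; rewrite gg'.
    by left; exists g, g'.
  by right; exists g', g.
- move=> _ _ k [g [g' [-> -> gg']]]; exists (g * k)%g, (g' * k)%g.
  by rewrite !translate1; split => //; exact: inv.
Qed.

(** [Bt] is simply connected, so the subgroup is trivial and its cosets are the
    elements of [pi1 R b0]. *)
Lemma universal_covering_right_orderable (R : realType) (Bt B : topologicalType)
    (q : continuousType Bt B) (b0 : B) (e0 : Bt) (qe0 : q e0 = b0) :
  universal_covering R q ->
  right_orderable (pi1 R b0) <-> orderable (coset_gset (range (pi1_map R q qe0))).
Proof.
move=> [_ [_ sc]]; rewrite -orderable_trivial_cosets.
suff -> : range (pi1_map R q qe0) = [set 1%g] by [].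
have map1 : pi1_map R q qe0 (loop_class (path_const R e0)) = 1%g.
  rewrite pi1_mapE; apply/loop_classP.
  have -> : map_loop qe0 (path_const R e0) = path_const R b0.
    by apply/path_eqP => t; rewrite /= /mk_path /=.
  exact: path_homotopic_refl.
apply/seteqP; split => [_ [g _ <-]|_ ->].
  by rewrite (sc e0 g) -(sc e0 (loop_class (path_const R e0))).
by exists (loop_class (path_const R e0)).
Qed.

Unset Implicit Arguments.

Theorem corollary4p6 (R : realType) (B : topologicalType) (b0 : B)
    (Bhausdorff : hausdorff_space B) (Bparacompact : paracompact B)
    (Bpc : path_connected R B) (Blpc : locally_path_connected R B)
    (Bslsc : semilocally_simply_connected R B)
    (Gcountable : countable [set: pi1 R b0]) :
  (forall (E : topologicalType) (p : continuousType E B) (e0 : E)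
          (pe0 : p e0 = b0),
     covering_map p -> path_connected R E ->
     (orderable (coset_gset (range (pi1_map R p pe0))) <->
      exists f : E -> R * B, bundle_embedding p f)) /\
  (forall (Bt : topologicalType) (q : continuousType Bt B),
     universal_covering R q ->
     (right_orderable (pi1 R b0) <->
      exists f : Bt -> R * B, bundle_embedding q f)).
Proof.
have main (E : topologicalType) (p : continuousType E B) (e0 : E)
    (pe0 : p e0 = b0) : covering_map p -> path_connected R E ->
    (orderable (coset_gset (range (pi1_map R p pe0))) <->
     exists f : E -> R * B, bundle_embedding p f).
  move=> covp pcE; split; last exact: bundle_embedding_orderable.
  exact: orderable_bundle_embedding.
split=> // Bt q uq; have [covq [[[e _] pcBt] _]] := uq.
have [_ /(_ (q e) b0 Logic.I Logic.I)[a _]] := Bpc.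
have [e0 [b qb]] := path_lifting covq a (erefl (q e)).
have qe0 : q e0 = b0 by rewrite -[e0](@path_one _ _ _ _ b) qb path_one.
rewrite (universal_covering_right_orderable qe0 uq); apply: main => //.
by have [_ []] := uq.
Qed.
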